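(* Let $X$ be a Banach space and let $A$ be the infinitesimal generator of a $C^0$-semigroup $(e^{tA})_{t\ge 0}$ of bounded linear operators on $X$. Let $f_i:X\to X$, $i=1,\dots,m$, be continuous vector fields which are Lipschitz on bounded sets and linearly bounded. Then for all $\xi_0\in X$ the reachable set $\mathcal{R}^1(\xi_0)$ of $$\dot x(t)=Ax(t)+\sum_{i=1}^m u_i(t)f_i\big(x(t)\big),\qquad x(0)=\xi_0,\qquad u_i\in L^1_{\rm loc}([0,\infty),\mathbb{R}),$$ can be written as a countable union of relatively compact sets and therefore has no interior points if $X$ is infinite-dimensional.
   Context: $X$ is real or complex. A map $f:X\to X$ is Lipschitz on bounded sets if for every bounded $C\subset X$ there is $L\ge 0$ with $\|f(\xi)-f(\eta)\|\le L\|\xi-\eta\|$ for all $\xi,\eta\in C$; it is linearly bounded if there are $\alpha,\beta\ge 0$ with $\|f(\xi)\|\le\alpha\|\xi\|+\beta$ for all $\xi\in X$. A mild solution on $[0,T]$ for the control $u=(u_1,\dots,u_m)\in L^1([0,T],\mathbb{R}^m)$ is a continuous $x:[0,T]\to X$ with $x(t)=e^{tA}\xi_0+\sum_{i=1}^m\int_0^t e^{(t-s)A}u_i(s)f_i(x(s))\,ds$ for all $t\in[0,T]$ (Bochner integral). Under the stated hypotheses it exists and is unique, and is denoted $x(\cdot,\xi_0,u)$. The reachable set is $$\mathcal{R}^1(\xi_0):=\bigcup_{T\ge 0}\{x(t,\xi_0,u): t\in[0,T],\ u\in L^1([0,T],\mathbb{R}^m)\}.$$ A set is relatively compact if its closure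 is compact. *)

(* Defs.v *)
From HB Require Import structures.
From mathcomp Require Import all_boot all_order all_algebra.
From mathcomp Require Import all_classical all_reals all_analysis.
From mathcomp Require Import complex.

Set Implicit Arguments.
Unset Strict Implicit.
Unset Printing Implicit Defensive.

Import Order.TTheory GRing.Theory Num.Theory.
Import numFieldNormedType.Exports.

Local Open Scope classical_set_scope.
Local Open Scope ring_scope.

Inductive scalar_kind := RealScalars | ComplexScalars.

Definition scalar_field (R : realType) (k : scalar_kind) : numFieldType :=
  match k with
  | RealScalars => R
  | ComplexScalars => R[i]
  end.

Definition scalar_of_real (R : realType) (k : scalar_kind) : R -> scalar_field R k :=
  match k return R -> scalar_field R k with
  | RealScalars => fun r => r
  | ComplexScalars => fun r => Complex r 0
  end.

Definition real_of_scalar (R : realType) (k : scalar_kind) : scalar_field R k -> R :=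
  match k return scalar_field R k -> R with
  | RealScalars => fun r => r
  | ComplexScalars => fun z => complex.Re z
  end.

Definition infinite_dimensional (K : numFieldType) (X : lmodType K) : Prop :=
  ~ exists (n : nat) (e : 'I_n -> X),
      forall x : X, exists c : 'I_n -> K, x = \sum_(i < n) c i *: e i.

Section BanachSpace.
Context {R : realType} {k : scalar_kind} {X : completeNormedModType (scalar_field R k)}.
Implicit Types f : X -> X.

(* The norm of a normed space over K is K-valued in the library;
   this is the same (nonnegative real) norm, with values in R. *)
Definition rnorm (x : X) : R := real_of_scalar `|x|.

Definition rscale (r : R) (x : X) : X := scalar_of_real k r *: x.

Definition bounded_operator (B : X -> X) : Prop :=
  exists2 M : scalar_field R k, 0 <= M & forall x, `|B x| <= M * `|x|.

(* Only the values of S at nonnegative times matter. *)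
Definition C0_semigroup (S : R -> {linear X -> X}) : Prop :=
  [/\ forall t, 0 <= t -> bounded_operator (S t),
      forall x, S 0 x = x,
      forall s t, 0 <= s -> 0 <= t -> forall x, S (s + t) x = S s (S t x) &
      forall x, S t x @[t --> 0^'+] --> x].

(* The unbounded operator A with domain domA; A is irrelevant outside domA. *)
Definition infinitesimal_generator (domA : set X) (A : X -> X)
    (S : R -> {linear X -> X}) : Prop :=
  (forall x, domA x <->
     exists y : X, rscale h^-1 (S h x - x) @[h --> 0^'+] --> y) /\
  (forall x, domA x -> rscale h^-1 (S h x - x) @[h --> 0^'+] --> A x).

Definition lipschitz_on_bounded_sets f : Prop :=
  forall C : set X, bounded_set C ->
    exists2 L : scalar_field R k, 0 <= L & L.-lipschitz_C f.

Definition linearly_bounded f : Prop :=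
  exists a b : scalar_field R k,
    [/\ 0 <= a, 0 <= b & forall x, `|f x| <= a * `|x| + b].

Section Bochner.
Context {d : measure_display} {T : measurableType d}.
Variable mu : {measure set T -> \bar R}.

Definition integrable_simple (D : set T) (s : {fimfun T >-> X}) : Prop :=
  (forall y : X, measurable (s @^-1` [set y])) /\
  (forall y : X, y != 0 -> (mu (D `&` s @^-1` [set y]) < +oo)%E).

Definition simple_integral (D : set T) (s : {fimfun T >-> X}) : X :=
  \sum_(y \in range s) rscale (fine (mu (D `&` s @^-1` [set y]))) y.

(* g is Bochner integrable on D, with Bochner integral v. *)
Definition is_bochner_integral (D : set T) (g : T -> X) (v : X) : Prop :=
  exists s : nat -> {fimfun T >-> X},
    [/\ forall n, integrable_simple D (s n),
        {ae mu, forall x, D x -> s n x @[n --> \oo] --> g x},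
        (\int[mu]_(x in D) (rnorm (g x - s n x))%:E)%E @[n --> \oo] --> 0%E &
        simple_integral D (s n) @[n --> \oo] --> v].

End Bochner.

Section ControlSystem.
Variables (S : R -> {linear X -> X}) (m : nat) (f : 'I_m -> X -> X) (xi0 : X).

Definition L1_control (T : R) (u : 'I_m -> R -> R) : Prop :=
  forall i, (@lebesgue_measure R).-integrable `[0, T] (EFin \o u i).

Definition mild_solution (T : R) (u : 'I_m -> R -> R) (x : R -> X) : Prop :=
  {within `[0, T], continuous x} /\
  forall t, t \in `[0, T] ->
    exists I : 'I_m -> X,
      (forall i, is_bochner_integral (@lebesgue_measure R) `[0, t]
                   (fun s => S (t - s) (rscale (u i s) (f i (x s)))) (I i)) /\
      x t = S t xi0 + \sum_(i < m) I i.

(* For Lipschitz, linearly bounded f the mild solution x exists and is unique,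
   so that x ranges over exactly one trajectory on `[0, T] for each u. *)
Definition reachable_set : set X :=
  [set y | exists T : R, 0 <= T /\
     exists u : 'I_m -> R -> R, L1_control T u /\
     exists x : R -> X, mild_solution T u x /\
     exists t : R, t \in `[0, T] /\ y = x t].

End ControlSystem.

End BanachSpace.

(* Main.v *)
(* Let K_(T, L) be the set of points x(t, xi0, u) with t <= T and L1-norm of u on
   [0, t] at most L. The reachable set is the union of the K_(n, n), so it suffices
   to show that each K_(T, L) is totally bounded; Baire's theorem and the finite
   dimension of Banach spaces with a totally bounded ball then give the empty
   interior.

   No weak compactness is available for controls in L1. Instead, increase the budget
   L by small steps delta. Along a trajectory of budget L + delta there is a time a
   such that x(s) lies in K_(T, L) for s <= a, while u has L1-norm at most delta on
   ]a, t]. Given a finite net of K_(T, L) and an e-net of K_(T, L + delta), the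
   vectors e^{(t-s)A} f_i(x(s)) stay close to finitely many points p_j: arbitrarily
   close for s <= a, and within O(e) for s > a. By the variation of constants formula
   x(t) is then within O(delta e) of the compact set of the e^{tA} xi0 + sum_j c_j p_j
   with |c_j| <= L + delta, so K_(T, L + delta) has a (3/4) e-net once delta is small,
   where delta depends only on T and on an upper bound for the budgets considered.
   Iterating over e, K_(T, L + delta) is totally bounded.
   The same splitting, with the linear bound on f_i, first shows that K_(T, L) is
   bounded. *)

Require Import Defs.
From HB Require Import structures.
From mathcomp Require Import all_boot all_order all_algebra.
From mathcomp Require Import all_classical all_reals all_analysis.
From mathcomp Require Import measurable_realfun complex ring lra.

Set Implicit Arguments.
Unset Strict Implicit.
Unset Printing Implicit Defensive.

Import Order.TTheory GRing.Theory Num.Theory.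
Import numFieldNormedType.Exports.

Local Open Scope classical_set_scope.
Local Open Scope ring_scope.

(** * The real Banach space underlying [X] *)

Section ScalarOfReal.
Context {R : realType} {k : scalar_kind}.
Implicit Types (r s : R) (z : scalar_field R k).
Local Notation sor := (@scalar_of_real R k).

Lemma scalar_of_realK r : real_of_scalar (sor r) = r.
Proof. by case: k. Qed.

Lemma scalar_of_realD r s : sor (r + s) = sor r + sor s.
Proof. by case: k => //=; rewrite [RHS]/GRing.add /= addr0. Qed.

Lemma scalar_of_realM r s : sor (r * s) = sor r * sor s.
Proof.
by case: k => //=; rewrite [RHS]/GRing.mul /= !mulr0 !mul0r subr0 addr0.
Qed.

Lemma scalar_of_real0 : sor 0 = 0.
Proof. by case: k. Qed.

Lemma scalar_of_real1 : sor 1 = 1.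
Proof. by case: k. Qed.

Lemma ler_scalar_of_real r s : (sor r <= sor s) = (r <= s).
Proof. by case: k => //=; rewrite lecE /= eqxx. Qed.

Lemma ltr_scalar_of_real r s : (sor r < sor s) = (r < s).
Proof. by case: k => //=; rewrite ltcE /= eqxx. Qed.

Lemma norm_scalar_of_real r : `|sor r| = sor `|r|.
Proof. by case: k => //=; rewrite normc_def /= expr0n addr0 sqrtr_sqr. Qed.

Lemma ge0_real_of_scalarK z : 0 <= z -> sor (real_of_scalar z) = z.
Proof.
by case: k z => //= -[a b]; rewrite lecE /= => /andP[/eqP -> _].
Qed.

Lemma real_of_scalar_ge0 z : 0 <= z -> 0 <= real_of_scalar z.
Proof. by move=> z0; rewrite -ler_scalar_of_real scalar_of_real0 ge0_real_of_scalarK. Qed.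

Lemma real_of_scalar_gt0 z : 0 < z -> 0 < real_of_scalar z.
Proof.
by move=> z0; rewrite -ltr_scalar_of_real scalar_of_real0 ge0_real_of_scalarK// ltW.
Qed.

End ScalarOfReal.

Section RealNorm.
Context {R : realType} {k : scalar_kind} {X : completeNormedModType (scalar_field R k)}.
Implicit Types (x y : X) (r s : R).

Lemma scalar_of_rnorm x : scalar_of_real k (rnorm x) = `|x|.
Proof. exact: ge0_real_of_scalarK. Qed.

Lemma rnormD x y : rnorm (x + y) <= rnorm x + rnorm y.
Proof.
by rewrite -(ler_scalar_of_real (k := k)) scalar_of_realD !scalar_of_rnorm ler_normD.
Qed.

Lemma rnormZ r x : rnorm (rscale r x) = `|r| * rnorm x.
Proof.
apply: (can_inj (@scalar_of_realK R k)).
by rewrite scalar_of_realM -norm_scalar_of_real !scalar_of_rnorm normrZ.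
Qed.

Lemma rnorm0_eq0 x : rnorm x = 0 -> x = 0.
Proof.
move=> /(congr1 (scalar_of_real k)); rewrite scalar_of_real0 scalar_of_rnorm.
by move/normr0_eq0.
Qed.

Lemma rscaleA r s x : rscale r (rscale s x) = rscale (r * s) x.
Proof. by rewrite /rscale scalar_of_realM scalerA. Qed.

Lemma rscale1 : left_id 1 (@rscale R k X).
Proof. by move=> x; rewrite /rscale scalar_of_real1 scale1r. Qed.

Lemma rscaleDr : right_distributive (@rscale R k X) +%R.
Proof. by move=> r x y; rewrite /rscale scalerDr. Qed.

Lemma rscaleDl x : {morph (@rscale R k X)^~ x : r s / r + s}.
Proof. by move=> r s; rewrite /rscale scalar_of_realD scalerDl. Qed.

End RealNorm.

(** The same points with a second structure, that of a real Banach space normed by [rnorm]. The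
    analysis is done there, once for both kinds of scalars, and then carried back to [X]. *)
Definition realified (R : realType) (k : scalar_kind)
  (X : completeNormedModType (scalar_field R k)) : Type := X.

Section Realified.
Context {R : realType} {k : scalar_kind} {X : completeNormedModType (scalar_field R k)}.
Local Notation Y := (realified X).

HB.instance Definition _ := GRing.Zmodule.copy Y X.
HB.instance Definition _ := GRing.Zmodule_isLmodule.Build R Y
  (@rscaleA R k X) rscale1 rscaleDr rscaleDl.
HB.instance Definition _ := Lmodule_isNormed.Build R Y (@rnormD R k X) rnormZ
  (@rnorm0_eq0 R k X).

Lemma realified_nbhsE (x : X) (A : set X) :
  nbhs (x : Y) A <-> nbhs x A.
Proof.
split=> /nbhs_ballP[e e0 xA]; apply/nbhs_ballP.
  exists (scalar_of_real k e) => /=.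
    by rewrite -(scalar_of_real0 (k := k)) ltr_scalar_of_real.
  move=> y; rewrite -ball_normE /= => xy; apply: xA; rewrite -ball_normE /=.
  by rewrite -(ltr_scalar_of_real (k := k)) scalar_of_rnorm.
exists (real_of_scalar e) => /=; first exact: real_of_scalar_gt0.
move=> y; rewrite -ball_normE /= => xy; apply: xA; rewrite -ball_normE /=.
by rewrite -scalar_of_rnorm -[e]ge0_real_of_scalarK 1?ltW// ltr_scalar_of_real.
Qed.

Lemma realified_cvgE (F : set_system X) (x : X) :
  F --> (x : Y) <-> F --> x.
Proof. by split=> Fx A /realified_nbhsE /Fx. Qed.

Lemma realified_cauchy_cvg (F : set_system Y) :
  ProperFilter F -> cauchy F -> cvg F.
Proof.
move=> PF /cauchy_ballP cF.
have /cauchy_cvg cvF : cauchy (F : set_system X).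
  apply/cauchy_ballP => e e0.
  have := cF _ (real_of_scalar_gt0 e0).
  apply: filterS => -[y z] /=; rewrite -!ball_normE /= => yz.
  by rewrite -scalar_of_rnorm -[e]ge0_real_of_scalarK 1?ltW// ltr_scalar_of_real.
apply/cvg_ex; exists (lim (F : set_system X) : X).
exact/realified_cvgE.
Qed.

HB.instance Definition _ := Uniform_isComplete.Build Y realified_cauchy_cvg.

End Realified.

(** * Integral inequalities for vector-valued simple functions *)

Section HahnBanach.
Context {R : realType} {Y : normedModType R}.

(* Hahn-Banach in coordinates: [l] is a functional on the span of [v] and
   [P 0, ..., P (n - 1)] dominated by the norm and sending [v] to [`|v|]. *)
Lemma norming_coefs (n : nat) (P : nat -> Y) (v : Y) :
  exists l : nat -> R, forall (t : R) (b : nat -> R),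
    t * `|v| + \sum_(j < n) b j * l j <= `|t *: v + \sum_(j < n) b j *: P j|.
Proof.
elim: n => [|n [l lP]].
  exists (fun=> 0) => t b; rewrite !big_ord0 !addr0 normrZ.
  by rewrite ler_wpM2r// ler_norm.
pose phi (t : R) (b : nat -> R) : R := t * `|v| + \sum_(j < n) b j * l j.
pose z (t : R) (b : nat -> R) : Y := t *: v + \sum_(j < n) b j *: P j.
have phiz t b : phi t b <= `|z t b| := lP t b.
have phiZ c t b : phi (c * t) (fun j => c * b j) = c * phi t b.
  rewrite /phi mulrDr mulrA; congr (_ + _).
  by rewrite mulr_sumr; apply: eq_bigr => j _; rewrite mulrA.
have zZ c t b : z (c * t) (fun j => c * b j) = c *: z t b.
  rewrite /z scalerDr scalerA; congr (_ + _).
  by rewrite scaler_sumr; apply: eq_bigr => j _; rewrite scalerA.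
have phiD t b t' b' : phi (t + t') (fun j => b j + b' j) = phi t b + phi t' b'.
  rewrite /phi mulrDl addrACA; congr (_ + _).
  by rewrite -big_split /=; apply: eq_bigr => j _; rewrite mulrDl.
have zD t b t' b' : z (t + t') (fun j => b j + b' j) = z t b + z t' b'.
  rewrite /z scalerDl addrACA; congr (_ + _).
  by rewrite -big_split /=; apply: eq_bigr => j _; rewrite scalerDl.
(* One Hahn-Banach extension step: [EP] puts every lower bound for the value at [P n] below every
   upper bound, so the supremum [c] of the lower ones is admissible. *)
pose E := [set x : R | exists t b, x = phi t b - `|z t b - P n|].
have EP t b x : E x -> x <= `|z t b + P n| - phi t b.
  move=> [t' [b' ->]]; rewrite lerBlDr addrAC lerBrDr -phiD.
  apply: (le_trans (phiz _ _)); rewrite zD.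
  have -> : z t' b' + z t b = (z t b + P n) + (z t' b' - P n).
    by rewrite [RHS]addrACA subrr addr0 addrC.
  exact: ler_normD.
have E0 : E !=set0 by exists (phi 0 (fun=> 0) - `|z 0 (fun=> 0) - P n|); exists 0, (fun=> 0).
have supE : has_sup E.
  by split => //; exists (`|z 0 (fun=> 0) + P n| - phi 0 (fun=> 0)) => x /EP.
pose c := sup E.
have c_ge t b : phi t b - `|z t b - P n| <= c.
  by apply: ub_le_sup; [exact: supE.2|exists t, b].
have c_le t b : c <= `|z t b + P n| - phi t b.
  by apply: ge_sup => // x Ex; exact: EP.
exists (fun j => if j == n then c else l j) => t b.
have -> : t * `|v| + \sum_(j < n.+1) b j * (if j == n :> nat then c else l j)
    = phi t b + b n * c.
  rewrite big_ord_recr /= eqxx addrA; congr (_ + _ + _).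
  by apply: eq_bigr => j _; rewrite ltn_eqF.
have -> : t *: v + \sum_(j < n.+1) b j *: P j = z t b + b n *: P n.
  by rewrite big_ord_recr /= addrA.
(* Dividing by [|b n|] reduces the two signs to [c_ge] and [c_le]. *)
have [s0|s0|->] := ltgtP (b n) 0; last by rewrite mul0r scale0r !addr0.
- pose r := - b n; have r0 : 0 < r by rewrite oppr_gt0.
  have := c_ge (r^-1 * t) (fun j => r^-1 * b j).
  rewrite phiZ zZ -(ler_pM2l r0) mulrBr mulVKf ?gt_eqF//.
  rewrite -{1}[r]gtr0_norm// -normrZ scalerBr scalerA mulfV ?gt_eqF// scale1r.
  by rewrite /r scaleNr opprK; lra.
- have := c_le ((b n)^-1 * t) (fun j => (b n)^-1 * b j).
  rewrite phiZ zZ -(ler_pM2l s0) mulrBr mulVKf ?gt_eqF//.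
  rewrite -{2}[b n]gtr0_norm// -normrZ scalerDr scalerA mulfV ?gt_eqF// scale1r.
  by lra.
Qed.

(** Apply [norming_coefs] to the combination [v] itself: the choices [t = -1], [b = a] and [t = 1],
    [b = - a] make the right-hand side vanish and force the equality. *)
Lemma norming_functional (I : finType) (a : I -> R) (P : I -> Y) :
  exists2 l : I -> R, \sum_i a i * l i = `|\sum_i a i *: P i| &
    forall b : I -> R, \sum_i b i * l i <= `|\sum_i b i *: P i|.
Proof.
pose nth (T : Type) (F : I -> T) (d : T) (j : nat) : T :=
  if insub j is Some j' then F (enum_val (j' : 'I_#|I|)) else d.
have nthE T (F : I -> T) d (j : 'I_#|I|) : nth T F d j = F (enum_val j).
  by rewrite /nth valK.
set v := \sum_i a i *: P i.
have [l lP] := norming_coefs #|I| (nth _ P 0) v.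
have lI t (b : I -> R) :
    t * `|v| + \sum_i b i * l (enum_rank i) <= `|t *: v + \sum_i b i *: P i|.
  rewrite [X in _ + X <= _](reindex _ (onW_bij _ (enum_val_bij I))) /=.
  rewrite [X in _ <= `|_ + X|](reindex _ (onW_bij _ (enum_val_bij I))) /=.
  under [X in _ + X <= _]eq_bigr do rewrite enum_valK -(nthE _ b 0).
  under [X in `|_ + X|]eq_bigr do rewrite -(nthE _ b 0) -(nthE _ P 0).
  exact: lP.
exists (fun i => l (enum_rank i)); last first.
  by move=> b; have := lI 0 b; rewrite mul0r scale0r !add0r.
apply/eqP; rewrite eq_le; apply/andP; split.
  have := lI (-1) a; rewrite scaleN1r addNr normr0; lra.
have := lI 1 (fun i => - a i); rewrite scale1r.
under eq_bigr do rewrite mulNr.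
under [X in `|_ + X|]eq_bigr do rewrite scaleNr.
by rewrite !sumrN subrr normr0; lra.
Qed.

End HahnBanach.

Section IntegralNorm.
Context {R : realType} {Y : normedModType R}.
Context {d : measure_display} {T : measurableType d}.
Variable mu : {measure set T -> \bar R}.
Variables (D : set T) (mD : measurable D).

(* [g] need not be measurable, which matters because the norms integrated in
   [is_bochner_integral] are not known to be: the integral of a nonnegative function
   is a supremum over the simple functions below it, hence monotone in any case. *)
Lemma ge0_le_lower_integral (f g : T -> \bar R) :
  (forall x, D x -> 0 <= f x)%E -> (forall x, D x -> f x <= g x)%E ->
  (\int[mu]_(x in D) f x <= \int[mu]_(x in D) g x)%E.
Proof.
move=> f0 fg; rewrite !ge0_integralE//; last first.
  by move=> x Dx; rewrite (le_trans (f0 x Dx)) ?fg.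
apply: le_ereal_sup => _ [h hf <-]; exists h => // x.
apply: (le_trans (hf x)); rewrite /patch; case: ifPn => // xD.
by apply: fg; exact: set_mem.
Qed.

Lemma Rintegral_sum (I : finType) (w : I -> T -> R) :
  (forall i, mu.-integrable D (EFin \o w i)) ->
  \int[mu]_(x in D) (\sum_i w i x) = \sum_i \int[mu]_(x in D) w i x.
Proof.
move=> wint; rewrite /Rintegral.
under eq_integral do rewrite -sumEFin.
rewrite (@integral_sum _ _ _ mu D mD I (fun i => EFin \o w i))//.
by rewrite sum_fine// => i _; apply: integrable_fin_num => //; exact: wint.
Qed.

(** A functional [l] norming the vector on the left turns its norm into the integral of the scalar
    function [\sum_i w i x * l i], which is at most [q1 + q2]. As [q2] need not be measurable, [q1]
    is moved to the left and [q2] enters only through monotonicity. *)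
Lemma norm_sum_integral_le (I : finType) (w : I -> T -> R) (P : I -> Y)
    (q1 q2 : T -> R) :
  (forall i, mu.-integrable D (EFin \o w i)) ->
  mu.-integrable D (EFin \o q1) -> (forall x, D x -> 0 <= q2 x) ->
  (forall x, D x -> `|\sum_i w i x *: P i| <= q1 x + q2 x) ->
  (`|\sum_i (\int[mu]_(x in D) w i x) *: P i|%:E <=
    (\int[mu]_(x in D) q1 x)%:E + \int[mu]_(x in D) (q2 x)%:E)%E.
Proof.
move=> wint q1int q20 wq.
have [l <- lP] := norming_functional (fun i => \int[mu]_(x in D) w i x) P.
have wlint i : mu.-integrable D (EFin \o (fun x => w i x * l i)).
  by apply: eq_integrable (integrableZl mD (l i) (wint i)) => // x _ /=; rewrite mulrC.
have Sint : mu.-integrable D (EFin \o (fun x => \sum_i w i x * l i)).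
  apply: eq_integrable (integrable_sum (h := fun i => EFin \o (fun x => w i x * l i))
    mD (index_enum I) (fun i (_ : true) => wlint i)) => // x _ /=.
  by rewrite sumEFin.
have -> : \sum_i (\int[mu]_(x in D) w i x) * l i =
    \int[mu]_(x in D) (\sum_i w i x * l i).
  rewrite Rintegral_sum//; apply: eq_bigr => i _; exact/esym/RintegralZr.
pose k x := \sum_i w i x * l i - q1 x.
have kint : mu.-integrable D (EFin \o k).
  by apply: eq_integrable (integrableB mD Sint q1int).
rewrite -leeBlDl// -EFinB -RintegralB//.
rewrite -[leLHS]fineK//= fineK; last exact: integrable_fin_num.
apply: (@le_trans _ _ (\int[mu]_(x in D) (EFin \o k)^\+ x)%E).
  by apply: le_integral => //; [exact: integrable_funepos|move=> x _; rewrite funeposE le_max lexx].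
apply: ge0_le_lower_integral => x Dx; first exact: funepos_ge0.
rewrite funeposE ge_max /= !lee_fin q20// andbT /k lerBlDl.
exact: le_trans (lP _) (wq _ Dx).
Qed.

End IntegralNorm.

(** * Bochner integrals of functions close to finite combinations *)

Section BochnerApproximation.
Context {R : realType} {Y : completeNormedModType R}.
Context {d : measure_display} {T : measurableType d}.
Variable mu : {measure set T -> \bar R}.
Variables (D : set T) (mD : measurable D).
Local Notation integrable_simple := (@integrable_simple R RealScalars Y d T mu).
Local Notation simple_integral := (@simple_integral R RealScalars Y d T mu).

(** The weights are the indicators of the fibres over the nonzero values; the fibre over 0 is left
    out because its measure may be infinite. *)
Lemma simple_integral_sum (s : {fimfun T >-> Y}) : integrable_simple D s ->
  exists (n : nat) (w : 'I_n -> T -> R) (e : 'I_n -> Y),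
    [/\ forall j, mu.-integrable D (EFin \o w j),
        forall x, s x = \sum_j w j x *: e j &
        simple_integral D s = \sum_j (\int[mu]_(x in D) w j x) *: e j].
Proof.
move=> [ms fs].
have fr : finite_set (range s) by exact: fimfunP.
pose r := [seq y <- finmap.enum_fset (fset_set (range s)) | y != 0].
have ur : uniq r by rewrite filter_uniq// finmap.fset_uniq.
have rP y : (y \in r) = (y != 0) && (y \in range s).
  by rewrite mem_filter in_fset_set.
exists (size r), (fun j => \1_(s @^-1` [set tnth (in_tuple r) j])),
  (fun j => tnth (in_tuple r) j).
have r0 j : tnth (in_tuple r) j != 0.
  by have := mem_tnth j (in_tuple r); rewrite rP => /andP[].
split.
- move=> j; apply/integrableP; split.
    apply/measurable_EFinP; apply: measurable_indic; exact: ms.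
  under eq_integral => x _ do rewrite /= ger0_norm//.
  by rewrite integral_indic// setIC; exact: fs.
- move=> x.
  rewrite -(big_tnth _ _ r xpredT (fun y => \1_(s @^-1` [set y]) x *: y)).
  have [sx0|sx0] := eqVneq (s x) 0.
    rewrite sx0 big1_seq// => y /=; rewrite rP => /andP[y0 _].
    rewrite indicE memNset ?scale0r//= => sxy.
    by move: y0; rewrite -sxy sx0 eqxx.
  rewrite (bigD1_seq (s x))//=; last by rewrite rP sx0 inE/=; exists x.
  rewrite indicE mem_set// scale1r big1 ?addr0// => y yx.
  by rewrite indicE memNset ?scale0r//= => xy; rewrite xy eqxx in yx.
- rewrite -(big_tnth _ _ r xpredT
    (fun y => (\int[mu]_(x in D) \1_(s @^-1` [set y]) x) *: y)).
  rewrite /Defs.simple_integral (fsbigE r)//.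
  + rewrite [RHS]big_seq_cond [LHS]big_seq_cond; apply: eq_big => [y|y _].
      by rewrite rP; case: (y \in range s); rewrite ?andbT ?andbF.
    by rewrite /Rintegral integral_indic// setIC.
  + by move=> y /=; rewrite rP => /andP[_ /set_mem].
  + move=> y sy; rewrite rP mem_set// andbT negbK => /eqP ->.
    exact: scaler0.
Qed.

(** An approximating simple function [s n] is merged with the given combination into a single one,
    of norm at most [q + |h - s n|] pointwise. [norm_sum_integral_le] bounds its integral, and the
    second term tends to 0 with [n]. *)
Lemma bochner_integral_approx (I : finType) (h : T -> Y) (v : Y)
    (w : I -> T -> R) (P : I -> Y) (q : T -> R) :
  @is_bochner_integral R RealScalars Y d T mu D h v ->
  (forall i, mu.-integrable D (EFin \o w i)) ->
  mu.-integrable D (EFin \o q) ->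
  (forall x, D x -> `|h x - \sum_i w i x *: P i| <= q x) ->
  `|v - \sum_i (\int[mu]_(x in D) w i x) *: P i| <= \int[mu]_(x in D) q x.
Proof.
move=> [s [ss _ s_int s_v]] wint qint hq.
set V := \sum_i _.
have sV n : (`|V - simple_integral D (s n)|%:E <= (\int[mu]_(x in D) q x)%:E +
    \int[mu]_(x in D) (`|h x - s n x|)%:E)%E.
  have [p [w' [e [w'int sE ->]]]] := simple_integral_sum (ss n).
  pose W (i : I + 'I_p) := match i with inl i => w i | inr j => w' j end.
  pose Q (i : I + 'I_p) := match i with inl i => P i | inr j => - e j end.
  have -> : V - \sum_j (\int[mu]_(x in D) w' j x) *: e j =
      \sum_i (\int[mu]_(x in D) W i x) *: Q i.
    rewrite big_sumType /=; congr (_ + _); rewrite -sumrN.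
    by apply: eq_bigr => j _; rewrite scalerN.
  apply: norm_sum_integral_le => //; first by case.
  move=> x Dx; rewrite big_sumType /=.
  under [X in `|_ + X|]eq_bigr do rewrite scalerN.
  rewrite sumrN -sE (le_trans (ler_distD (h x) _ _))// lerD// distrC.
  exact: hq.
apply/ler_addgt0Pr => eps eps0.
have e20 : 0 < eps / 2 by rewrite divr_gt0.
have [n [n1 n2]] : exists n, `|v - simple_integral D (s n)| < eps / 2 /\
    (\int[mu]_(x in D) (`|h x - s n x|)%:E < (eps / 2)%:E)%E.
  have /fine_cvgP[fin_int /cvgrPdist_lt/(_ _ e20) int0] := s_int.
  have /cvgrPdist_lt/(_ _ e20) v0 := s_v.
  have [n [nv [ni nf]]] := filter_ex (filterI v0 (filterI int0 fin_int)).
  exists n; split; first exact: nv.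
  move: ni; rewrite sub0r normrN /= -lte_fin => ni; rewrite -(fineK nf).
  by apply: le_lt_trans ni; rewrite lee_fin ler_norm.
have := le_trans (sV n) (leeD2l _ (ltW n2)).
rewrite -EFinD lee_fin => Vn.
apply: (le_trans (ler_distD (simple_integral D (s n)) _ _)).
rewrite [X in _ + X]distrC; lra.
Qed.

End BochnerApproximation.

Section BochnerNets.
Context {R : realType} {Y : completeNormedModType R}.
Context {d : measure_display} {T : measurableType d}.
Variable mu : {measure set T -> \bar R}.
Variables (D : set T) (mD : measurable D).
Local Notation is_bochner_integral :=
  (@is_bochner_integral R RealScalars Y d T mu D).

Lemma bochner_integral_norm_le (u : T -> R) (g : T -> Y) (v : Y) (rho : T -> R) :
  is_bochner_integral (fun s => u s *: g s) v ->
  mu.-integrable D (EFin \o (fun s => `|u s| * rho s)) ->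
  (forall s, D s -> `|g s| <= rho s) ->
  `|v| <= \int[mu]_(s in D) (`|u s| * rho s).
Proof.
move=> gv urho grho.
(* Approximation by the empty combination. *)
have := @bochner_integral_approx _ _ _ _ mu D mD 'I_0 _ v (fun=> cst 0) (fun=> 0)
  (fun s => `|u s| * rho s) gv.
rewrite big_ord0 subr0; apply => //; first by case.
by move=> x Dx; rewrite big_ord0 subr0 normrZ ler_wpM2l// grho.
Qed.

(** [D] is partitioned according to the first [P j] within [rho s] of [g s]; the coefficient [c j]
    is the integral of [u] over the piece [F j]. *)
Lemma bochner_integral_near_net (u : T -> R) (g : T -> Y) (v : Y)
    (n : nat) (P : 'I_n -> Y) (rho : T -> R) :
  is_bochner_integral (fun s => u s *: g s) v ->
  mu.-integrable D (EFin \o u) ->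
  mu.-integrable D (EFin \o (fun s => `|u s| * rho s)) ->
  (forall j, measurable (D `&` [set s | `|g s - P j| <= rho s])) ->
  (forall s, D s -> exists j, `|g s - P j| <= rho s) ->
  exists c : 'I_n -> R, (forall j, `|c j| <= \int[mu]_(s in D) `|u s|) /\
    `|v - \sum_j c j *: P j| <= \int[mu]_(s in D) (`|u s| * rho s).
Proof.
move=> gv uint urho mE gP.
pose E j := D `&` [set s | `|g s - P j| <= rho s].
pose F j := E j `\` \big[setU/set0]_(i < n | (i < j)%N) E i.
have mF j : measurable (F j).
  by apply: measurableD; [exact: mE|apply: bigsetU_measurable => i _; exact: mE].
pose w j s := u s * \1_(F j) s.
have absint : mu.-integrable D (EFin \o (fun s => `|u s|)) by exact: integrable_norm.
have w_le j s : `|w j s| <= `|u s|.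
  rewrite /w indicE; case: (s \in F j); rewrite ?mulr1// mulr0 normr0.
  exact: normr_ge0.
have wint j : mu.-integrable D (EFin \o w j).
  apply: le_integrable absint => //.
    apply/measurable_EFinP/measurable_funM; last exact: measurable_indic.
    by apply/measurable_EFinP; exact: measurable_int uint.
  by move=> s _; rewrite lee_fin /= normr_id.
exists (fun j => \int[mu]_(s in D) w j s); split.
  move=> j; apply: le_trans (le_normr_Rintegral mD (wint j)) _.
  apply: le_Rintegral => //; exact: integrable_norm.
apply: bochner_integral_approx gv wint urho _ => // s Ds.
have [i0 gi0] := gP _ Ds.
have Ei0 : `[< E i0 s >] by apply/asboolP.
case: (@arg_minnP _ i0 (fun i => `[< E i s >]) (@nat_of_ord n) Ei0) => j /asboolP Ej jmin.
rewrite (bigD1 j)//= big1 => [|i ij].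
  rewrite addr0 /w indicE mem_set ?mulr1; last first.
    split => //; rewrite -bigcup_seq_cond => -[i /= /andP[_ ij] Ei].
    by have := jmin i; rewrite leqNgt ij => /(_ (asboolT Ei)).
  by rewrite -scalerBr normrZ ler_wpM2l//; exact: Ej.2.
rewrite /w indicE memNset ?mulr0 ?scale0r// => -[Ei]; apply.
rewrite -bigcup_seq_cond; exists j => //=; rewrite mem_index_enum /=.
have := jmin i (asboolT Ei).
by rewrite leq_eqVlt => /predU1P[/ord_inj ji|//]; rewrite ji eqxx in ij.
Qed.

End BochnerNets.

(** * Totally bounded sets *)

(** The centres may lie outside [A]; [finite_net_centers] moves them into [A] at the cost of
    doubling the radius. *)
Definition finite_net (K : numFieldType) (V : normedModType K) (e : K)
    (A : set V) : Prop :=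
  exists s : seq V, forall x, A x -> exists2 y, y \in s & `|x - y| < e.

Definition totally_bounded (K : numFieldType) (V : normedModType K)
    (A : set V) : Prop := forall e : K, 0 < e -> finite_net e A.

Section TotallyBounded.
Context {K : numFieldType} {V : normedModType K}.
Implicit Types (A B : set V) (e : K).

Lemma le_finite_net e e' A : e <= e' -> finite_net e A -> finite_net e' A.
Proof.
move=> ee' [s sP]; exists s => x /sP[y ys xy].
by exists y => //; exact: lt_le_trans xy ee'.
Qed.

Lemma finite_net_closure e e' A : 0 < e' ->
  finite_net e A -> finite_net (e + e') (closure A).
Proof.
move=> e'0 [s sP]; exists s => x /(_ _ (nbhsx_ballx x e' e'0))[a [/sP[y ys ay]]].
rewrite -ball_normE /= => xa; exists y => //.
by rewrite (le_lt_trans (ler_distD a _ _))// addrC ltrD.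
Qed.

Lemma totally_bounded_closure A : totally_bounded A -> totally_bounded (closure A).
Proof.
move=> tA e e0; have e20 : 0 < e / 2 by rewrite divr_gt0.
by rewrite [e]splitr; apply: finite_net_closure => //; exact: tA.
Qed.

Lemma finite_net_near e e' A B : finite_net e' B ->
  (forall x, A x -> exists2 y, B y & `|x - y| <= e) -> finite_net (e + e') A.
Proof.
move=> [s sP] AB; exists s => x /AB[y /sP[z zs yz] xy]; exists z => //.
by rewrite (le_lt_trans (ler_distD y _ _))// ler_ltD.
Qed.

Lemma finite_net_centers e A : finite_net e A ->
  exists s : seq V, (forall y, y \in s -> A y) /\
    (forall x, A x -> exists2 y, y \in s & `|x - y| < e + e).
Proof.
move=> [s sP].
have [h hP] : {h : V -> V & forall y, (exists2 x, A x & `|x - y| < e) ->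
    A (h y) /\ `|h y - y| < e}.
  apply: (@choice _ _ (fun y z =>
    (exists2 x, A x & `|x - y| < e) -> A z /\ `|z - y| < e)) => y.
  have [[x Ax xy]|nx] := pselect (exists2 x, A x & `|x - y| < e).
    by exists x.
  by exists 0 => /nx.
exists [seq h y | y <- s & `[< exists2 x, A x & `|x - y| < e >]]; split.
  move=> _ /mapP[y + ->]; rewrite mem_filter => /andP[/asboolP /hP[]//].
move=> x Ax; have [y ys xy] := sP _ Ax.
have yx : exists2 x, A x & `|x - y| < e by exists x.
exists (h y); first by apply: map_f; rewrite mem_filter ys andbT; exact/asboolP.
have [_ hy] := hP _ yx.
by rewrite (le_lt_trans (ler_distD y _ _))// ltrD// distrC.
Qed.

Lemma totally_boundedS A B : A `<=` B -> totally_bounded B -> totally_bounded A.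
Proof. by move=> AB tB e /tB[s sP]; exists s => x /AB /sP. Qed.

Lemma totally_bounded1 (x : V) : totally_bounded [set x].
Proof.
move=> e e0; exists [:: x] => _ ->; exists x; first exact: mem_head.
by rewrite subrr normr0.
Qed.

Lemma totally_boundedD A B : totally_bounded A -> totally_bounded B ->
  totally_bounded [set x + y | x in A & y in B].
Proof.
move=> tA tB e e0; have e20 : 0 < e / 2 by rewrite divr_gt0.
have [[s sP] [r rP]] := (tA _ e20, tB _ e20).
exists [seq x + y | x <- s, y <- r] => _ [x /sP[a sa xa]] [y /rP[b rb yb] <-].
exists (a + b); first exact: allpairs_f.
by rewrite opprD addrACA (le_lt_trans (ler_normD _ _))// [e]splitr ltrD.
Qed.

Lemma totally_bounded_sum (n : nat) (A : 'I_n -> set V) :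
  (forall i, totally_bounded (A i)) ->
  totally_bounded [set \sum_i x i | x in [set x | forall i, A i (x i)]].
Proof.
elim: n A => [|n IHn] A tA.
  apply: totally_boundedS (totally_bounded1 0) => _ [x _ <-].
  by rewrite big_ord0.
apply: totally_boundedS (totally_boundedD (tA ord0) (IHn _ (fun i => tA (lift ord0 i)))).
move=> _ [x Ax <-]; rewrite big_ord_recl.
exists (x ord0); first exact: Ax.
by exists (\sum_(i < n) x (lift ord0 i)) => //; exists (fun i => x (lift ord0 i)).
Qed.

Lemma totally_bounded_bigcup (Z : eqType) (s : seq Z) (A : Z -> set V) :
  (forall z, z \in s -> totally_bounded (A z)) ->
  totally_bounded [set x | exists2 z, z \in s & A z x].
Proof.
move=> tA e e0; elim: s tA => [_|z s IHs tA]; first by exists [::] => x [].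
have [r rP] := tA z (mem_head _ _) _ e0.
have [r' r'P] := IHs (fun z' zs => tA z' (mem_behead (s := z :: s) zs)).
exists (r ++ r') => x [z']; rewrite inE => /predU1P[->|z's] Ax.
  by have [y yr xy] := rP _ Ax; exists y => //; rewrite mem_cat yr.
have [|y yr xy] := r'P x; first by exists z'.
by exists y => //; rewrite mem_cat yr orbT.
Qed.

Lemma compact_totally_bounded A : compact A -> totally_bounded A.
Proof.
rewrite compact_cover => cA e e0.
have [//|x Ax|D _ AD] := cA V A (fun x => ball x e).
- by move=> x _; exact: ball_open.
- by exists x => //; exact: ballxx.
exists (finmap.enum_fset D) => x /AD[y yD]; rewrite -ball_normE /= => yx.
by exists y => //; rewrite distrC.
Qed.

End TotallyBounded.

(** An ultrafilter containing the closure contains a ball of every given radius, by finite nets; so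
    it is Cauchy and converges. *)
Lemma totally_bounded_compact_closure (K : numFieldType)
    (V : completeNormedModType K) (A : set V) :
  totally_bounded A -> compact (closure A).
Proof.
move=> /totally_bounded_closure tA; rewrite compact_ultra => F UF FA.
have : cvg F.
  apply: cauchy_cvg; apply: cauchy_exP => e e0.
  have [s sP] := tA _ e0.
  have : F [set x | exists2 y, y \in s & `|x - y| < e] by apply: filterS FA.
  (* Centres are dropped one by one: if the ball around [y] is not in the ultrafilter, its
     complement is, and the remaining balls still cover a member. *)
  elim: s {sP} => [|y s IHs] Fs.
    by case: (@filter_not_empty _ F _); apply: filterS Fs => x [].
  have [Fy|Fy] := in_ultra_setVsetC (ball y e) UF; first by exists y.
  apply: IHs; apply: filterS (filterI Fs Fy) => x [[z +] xz].
  rewrite inE => /predU1P[zy|zs]; last by exists z.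
  by case; rewrite -ball_normE /= -zy distrC.
move=> /cvg_ex[p Fp]; exists p; split => //.
apply: closed_closure => B /Fp FB; exact: filter_ex (filterI FA FB).
Qed.

(** * Totally bounded balls and finite dimension *)

Section FiniteDimension.
Context {R : realType} {Y : normedModType R}.

(* With [x = y_0 + z_1 / 2], [z_1 = y_1 + z_2 / 2], ..., each [y_k] in the net and
   each remainder [z_k] in the ball, [x] is the sum of the [y_k / 2 ^ k]: grouping
   equal [y_k] writes [x] as a finite combination of the points of the net. *)
Lemma ball_finite_net_finite_dimensional (r : R) : 0 < r ->
  finite_net (r / 2) [set y : Y | `|y| < r] ->
  exists (n : nat) (e : 'I_n -> Y),
    forall x : Y, exists c : 'I_n -> R, x = \sum_(i < n) c i *: e i.
Proof.
move=> r0 [s sP].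
exists (size s), (fun i => nth 0 s i).
suff ballP x : `|x| < r ->
    exists c : 'I_(size s) -> R, x = \sum_i c i *: nth 0 s i.
  move=> x; pose t := r / (2 * (`|x| + 1)).
  have x0 : 0 < `|x| + 1 by rewrite ltr_wpDl.
  have t0 : 0 < t by rewrite divr_gt0// mulr_gt0.
  have [|c xc] := ballP (t *: x).
    rewrite normrZ gtr0_norm// /t mulrAC ltr_pdivrMr ?mulr_gt0//.
    rewrite ltr_pM2l//; have := normr_ge0 x; lra.
  exists (fun i => t^-1 * c i).
  under eq_bigr do rewrite -scalerA.
  by rewrite -scaler_sumr -xc scalerA mulVf ?gt_eqF// scale1r.
move=> xr.
have [h hP] : {h : Y -> Y & forall z, `|z| < r -> h z \in s /\ `|z - h z| < r / 2}.
  apply: (@choice _ _ (fun z y => `|z| < r -> y \in s /\ `|z - y| < r / 2)) => z.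
  have [/sP[y ys zy]|zr] := ltP `|z| r; first by exists y.
  by exists 0.
pose z k := iter k (fun z => 2 *: (z - h z)) x.
have zr k : `|z k| < r.
  elim: k => //= k /hP[_]; rewrite normrZ gtr0_norm//; lra.
(* The contribution [2 ^- k] of step [k] is credited to the index of its net point, so each series
   is dominated by a geometric one. *)
pose u (i : 'I_(size s)) k : R := (index (h (z k)) s == i)%:R * 2^-1 ^+ k.
have uint i : cvgn (series (u i)).
  apply: (@series_le_cvg _ _ (geometric 1 2^-1)).
  - by move=> k; rewrite mulr_ge0// exprn_ge0.
  - by move=> k; rewrite /= mul1r exprn_ge0.
  - by move=> k; rewrite /= ler_wpM2r ?exprn_ge0//; case: (_ == _).
  - by apply: is_cvg_geometric_series; rewrite gtr0_norm// invf_lt1// ltr1n.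
pose S k : Y := \sum_i series (u i) k *: nth 0 s i.
have SE k : x = S k + 2^-1 ^+ k *: z k.
  elim: k => [|k {1}->].
    rewrite /S big1 ?add0r ?expr0 ?scale1r// => i _.
    by rewrite seriesEnat /= big_geq// scale0r.
  have -> : S k.+1 = S k + 2^-1 ^+ k *: h (z k).
    rewrite /S; under eq_bigr => i _ do rewrite seriesSr scalerDl.
    rewrite big_split /=; congr (_ + _).
    have hs : (index (h (z k)) s < size s)%N by rewrite index_mem; case: (hP _ (zr k)).
    rewrite (bigD1 (Ordinal hs))//= big1 ?addr0 => [|i /eqP ij].
      by rewrite /u eqxx mul1r nth_index// -index_mem.
    rewrite /u; case: eqP => [ki|_]; last by rewrite mul0r scale0r.
    by case: ij; exact/val_inj.
  rewrite -addrA; congr (_ + _).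
  by rewrite exprSr /= scalerA divfK ?pnatr_eq0// -scalerDr addrC subrK.
exists (fun i => limn (series (u i))).
apply: (@cvg_unique _ (@norm_hausdorff _ Y) (S @ \oo)).
  apply/cvgrPdist_lt => e e0.
  have : `|2^-1 : R| < 1 by rewrite gtr0_norm// invf_lt1// ltr1n.
  move=> /(cvg_geometric r) /cvgrPdist_lt /(_ e e0); apply: filterS => k.
  rewrite sub0r normrN => /(le_lt_trans _); apply.
  rewrite {1}(SE k) addrC addKr normrZ mulrC normrM [`|r|]gtr0_norm//.
  by rewrite ler_wpM2r// ltW.
apply: cvg_big => [|i _]; first exact: add_continuous.
by apply: cvgZl; exact: uint.
Qed.

End FiniteDimension.

(** By Baire, the closure of some [K n] contains a ball. That ball has a net of half its radius;
    translating both to the origin gives the hypothesis of [ball_finite_net_finite_dimensional]. *)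
Lemma bigcup_totally_bounded_ball (R : realType) (Y : completeNormedModType R)
    (K : nat -> set Y) (x0 : Y) (r0 : R) :
  0 < r0 -> (forall n, totally_bounded (K n)) -> ball x0 r0 `<=` \bigcup_n K n ->
  exists (n : nat) (e : 'I_n -> Y),
    forall x : Y, exists c : 'I_n -> R, x = \sum_(i < n) c i *: e i.
Proof.
move=> r00 tK x0K.
have [n ndense] : exists n, ~ dense (~` closure (K n)).
  apply: contrapT => /forallNP ndense.
  have dK : dense (\bigcap_n ~` closure (K n)).
    apply: Baire => n; split; last by apply: contrapT; exact: ndense.
    by apply: closed_openC; exact: closed_closure.
  have [y [x0y yK]] : ball x0 r0 `&` \bigcap_n ~` closure (K n) !=set0.
    by apply: dK; [exists x0; exact: ballxx|exact: ball_open].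
  have [n _ Kn] := x0K _ x0y; apply: (yK n) => //; exact: subset_closure.
have [U [[x /open_nbhs_nbhs /nbhs_ballP[r /= r_gt0 xrU]] UK]] := denseNE ndense.
have xrK : ball x r `<=` closure (K n).
  move=> y /xrU Uy; apply: contrapT => yK.
  by have : (U `&` ~` closure (K n)) y by []; rewrite UK.
apply: (@ball_finite_net_finite_dimensional R Y r) => //.
have [s sP] := totally_bounded_closure (tK n) (divr_gt0 r_gt0 (ltr0n _ 2)).
exists [seq y - x | y <- s] => y yr; have [|z zs yz] := sP (y + x).
  by apply: xrK; rewrite -ball_normE /= opprD addrCA subrr addr0 normrN.
by exists (z - x); [exact: map_f|rewrite opprB addrA].
Qed.

(** * Strongly continuous semigroups *)

Section Semigroup.
Context {R : realType} {Y : completeNormedModType R}.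
Variable S : R -> {linear Y -> Y}.
Hypothesis S_bounded : forall t : R, 0 <= t ->
  exists2 M : R, 0 <= M & forall x, `|S t x| <= M * `|x|.
Hypothesis S0 : forall x, S 0 x = x.
Hypothesis SD : forall s t : R, 0 <= s -> 0 <= t -> forall x, S (s + t) x = S s (S t x).
Hypothesis S_cvg0 : forall x, S t x @[t --> 0^'+] --> x.

Lemma semigroup_near0 (x : Y) (e : R) : 0 < e ->
  exists2 d, 0 < d & forall t, 0 <= t < d -> `|S t x - x| < e.
Proof.
move=> e0; have /cvgrPdist_lt/(_ _ e0) := @S_cvg0 x.
rewrite near_withinE => /nbhs_ballP[d /= d0 dP]; exists d => // t /andP[].
rewrite le_eqVlt => /predU1P[<- _|t0 td]; first by rewrite S0 subrr normr0.
rewrite distrC; apply: dP => //.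
by rewrite -ball_normE /= sub0r normrN gtr0_norm.
Qed.

(** Otherwise there are times [t n] tending to 0 at which the operator norm exceeds [n + 1],
    although every orbit is bounded along these times. This contradicts Banach-Steinhaus. *)
Lemma semigroup_bounded_near0 :
  exists (d M : R), [/\ 0 < d, 1 <= M &
    forall t x, 0 <= t <= d -> `|S t x| <= M * `|x|].
Proof.
apply: contrapT => nSM.
have [t tP] : {t : nat -> R & forall n, 0 <= t n <= n.+1%:R^-1 /\
    exists x, n.+1%:R * `|x| < `|S (t n) x|}.
  apply: (@choice _ _ (fun n t => 0 <= t <= n.+1%:R^-1 /\
    exists x, n.+1%:R * `|x| < `|S t x|)) => n.
  apply: contrapT => nt; apply: nSM; exists n.+1%:R^-1, n.+1%:R; split.
  - by rewrite invr_gt0.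
  - by rewrite ler1n.
  - move=> t x tn; rewrite leNgt; apply/negP => Sx; apply: nt.
    by exists t; split => //; exists x.
have [||M SM] := @Banach_Steinhauss R Y Y [set (S (t n) : Y -> Y) | n in setT] _ _ 1.
- move=> _ [n _ <-]; split; last exact: linearP.
  have [/andP[tn0 _] _] := tP n; have [M M0 SM] := S_bounded tn0.
  by move=> r; exists (M * r) => x xr; rewrite (le_trans (SM x))// ler_wpM2l.
- move=> x; have [d d0 dP] := semigroup_near0 x ltr01.
  have [N Nd] : exists N, forall n, (N <= n)%N -> t n < d.
    exists (Num.truncn d^-1) => n Nn; have [/andP[_ tn] _] := tP n.
    rewrite (le_lt_trans tn)// invf_plt ?posrE//.
    by rewrite (lt_le_trans (truncnS_gt _))// ler_nat ltnS.
  (* The sum bounds the first [N] values; the later ones are within 1 of [x]. *)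
  exists (`|x| + 1 + \sum_(k < N) `|S (t k) x|) => _ [n _ <-].
  have sum0 : 0 <= \sum_(k < N) `|S (t k) x| by exact: sumr_ge0.
  have [nN|Nn] := ltnP n N.
    rewrite (bigD1 (Ordinal nN))//= addrCA lerDl !addr_ge0//.
    by rewrite sumr_ge0.
  have [/andP[tn0 _] _] := tP n.
  have := dP (t n); rewrite tn0 Nd// => /(_ isT) Sx.
  by have := ler_normD (S (t n) x - x) x; rewrite subrK; lra.
- have [_ [x xM]] := tP (Num.truncn M).
  have x0 : 0 < `|x|.
    rewrite normr_gt0; apply: contraTneq xM => ->.
    by rewrite linear0 normr0 mulr0 ltxx.
  have := SM _ (ex_intro2 _ _ (Num.truncn M) I erefl) (`|x|^-1 *: x).
  rewrite linearZ !normrZ normfV normr_id mulVf ?gt_eqF// => /(_ (lexx _)).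
  rewrite mulrC ler_pdivrMr// => xM'.
  have := lt_le_trans xM xM'; rewrite ltr_pM2r// ltNge => /negP; apply.
  by rewrite ltW// truncnS_gt.
Qed.

Lemma semigroup_bounded (T : R) :
  exists2 M : R, 1 <= M & forall t x, 0 <= t <= T -> `|S t x| <= M * `|x|.
Proof.
have [d [M [d0 M1 SM]]] := semigroup_bounded_near0.
have M0 : 0 <= M by exact: le_trans M1.
(* Each step of length [d] costs a factor [M]; [1 <= M] takes care of a shorter last step. *)
have SMn n t x : 0 <= t <= d * n%:R -> `|S t x| <= M ^+ n * `|x|.
  elim: n t x => [|n IHn] t x.
    by rewrite mulr0 -eq_le => /eqP <-; rewrite S0 mul1r.
  move=> /andP[t0 tn].
  have [td|dt] := leP t d.
    apply: (le_trans (SM _ _ _)); first by rewrite t0.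
    by rewrite exprS ler_wpM2r// ler_peMr// exprn_ege1.
  rewrite -[t](subrK d) SD ?subr_ge0; [|exact: ltW..].
  have td : 0 <= t - d <= d * n%:R.
    by rewrite subr_ge0 ltW//= lerBlDr; move: tn; rewrite -natr1 mulrDr mulr1.
  apply: (le_trans (IHn _ _ td)); rewrite exprSr -mulrA ler_wpM2l ?exprn_ge0// SM// lexx ltW//.
exists (M ^+ (Num.truncn (T / d)).+1); first exact: exprn_ege1.
move=> t x /andP[t0 tT]; apply: SMn; rewrite t0 (le_trans tT)//.
by rewrite mulrC -ler_pdivrMr// ltW// truncnS_gt.
Qed.

(** For [r <= s] the difference is [S r] applied to [S (s - r) x - x], so right continuity at 0 and
    the bound [M] give continuity from both sides. *)
Lemma semigroup_orbit_unif_continuous (T : R) (x : Y) (e : R) : 0 < e ->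
  exists2 d, 0 < d & forall r s, 0 <= r <= T -> 0 <= s <= T -> `|s - r| < d ->
    `|S s x - S r x| < e.
Proof.
move=> e0; have [M M1 SM] := semigroup_bounded T.
have M0 : 0 < M by exact: lt_le_trans M1.
have [d d0 dP] := semigroup_near0 x (divr_gt0 e0 M0).
have SB r s : 0 <= r -> r <= s -> s <= T -> s - r < d -> `|S s x - S r x| < e.
  move=> r0 rs sT srd.
  rewrite -[s](subrKC r) SD ?subr_ge0// -linearB.
  apply: (le_lt_trans (SM _ _ _)); first by rewrite r0 (le_trans rs).
  by rewrite mulrC -ltr_pdivlMr// dP// subr_ge0 rs.
exists d => // r s /andP[r0 rT] /andP[s0 sT].
have [rs|sr] := leP r s; first by rewrite ger0_norm ?subr_ge0//; exact: SB.
by rewrite ltr0_norm ?subr_lt0// opprB distrC; apply: SB => //; exact: ltW.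
Qed.

Lemma semigroup_orbit_continuous (T : R) (x : Y) :
  {within `[0, T], continuous (fun t => S t x)}.
Proof.
apply/subspace_continuousP => t /=; rewrite in_itv /= => tT.
apply/cvgrPdist_lt => e e0.
have [d d0 dP] := semigroup_orbit_unif_continuous T x e0.
rewrite near_withinE; near=> s; rewrite /= in_itv /= => sT.
apply: dP => //; near: s; exact: (@cvgr_dist_lt _ _ _ (nbhs t) _ id).
Unshelve. all: by end_near. Qed.

(** Compare through [S (t - s) (h r)]: orbit continuity handles the change of time, the uniform
    bound [M] the change of point. This serves the measurability condition of
    [bochner_integral_near_net]. *)
Lemma semigroup_shift_continuous (t : R) (h : R -> Y) :
  {within `[0, t], continuous h} ->
  {within `[0, t], continuous (fun s => S (t - s) (h s))}.
Proof.
move=> /subspace_continuousP hc.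
have [M M1 SM] := semigroup_bounded t.
have M0 : 0 < M by exact: lt_le_trans M1.
apply/subspace_continuousP => r r0t; have := r0t; rewrite /= in_itv /= => /andP[r0 rt].
apply/cvgrPdist_lt => e e0; have e20 : 0 < e / 2 by rewrite divr_gt0.
have [d d0 dP] := semigroup_orbit_unif_continuous t (h r) e20.
have /cvgrPdist_lt/(_ _ (divr_gt0 e20 M0)) := hc r r0t.
rewrite !near_withinE => hr; near=> s => s0t.
have := s0t; rewrite /= in_itv /= => /andP[s0 st].
apply: (le_lt_trans (ler_distD (S (t - s) (h r)) _ _)).
rewrite [e]splitr ltrD//.
  apply: dP; [lra|lra|].
  rewrite (_ : t - r - (t - s) = s - r); last by ring.
  by rewrite distrC; near: s; exact: (@cvgr_dist_lt _ _ _ (nbhs r) _ id).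
rewrite -linearB; apply: (le_lt_trans (SM _ _ _)); first lra.
rewrite mulrC -ltr_pdivlMr//; move: s0t; near: s; exact: hr.
Unshelve. all: by end_near. Qed.

End Semigroup.

(** * Integrals over initial intervals and the splitting time *)

Section RealIntegrals.
Context {R : realType}.
Notation mu := (@lebesgue_measure R).
Implicit Types (h : R -> R) (a t : R).

Lemma integrable_prefix h s t : s <= t ->
  mu.-integrable `[0, t] (EFin \o h) -> mu.-integrable `[0, s] (EFin \o h).
Proof.
move=> st; apply: integrableS => //.
by apply: subset_itvl; rewrite bnd_simp.
Qed.

Lemma le_Rintegral_prefix h s t : 0 <= s -> s <= t ->
  mu.-integrable `[0, t] (EFin \o h) -> (forall r, 0 <= h r) ->
  \int[mu]_(r in `[0, s]) h r <= \int[mu]_(r in `[0, t]) h r.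
Proof.
move=> s0 st hint h0; rewrite -subr_ge0 Rintegral_itvB//.
exact: Rintegral_ge0.
Qed.

Lemma integrableM_indic_ray h t a : mu.-integrable `[0, t] (EFin \o h) ->
  mu.-integrable `[0, t] (EFin \o (fun s => h s * \1_(`]a, +oo[%classic) s)).
Proof.
move=> hint; apply: le_integrable (hint) => //.
  apply/measurable_EFinP/measurable_funM; last exact: measurable_indic.
  by apply/measurable_EFinP; exact: measurable_int hint.
move=> s _ /=; rewrite lee_fin indicE.
by case: (s \in _); rewrite ?mulr1// mulr0 normr0.
Qed.

(** The weight is the error profile of a trajectory split at time [a]: [A] up to [a], and [A + B]
    afterwards. *)
Lemma integrableM_step h t a (A B : R) : mu.-integrable `[0, t] (EFin \o h) ->
  mu.-integrable `[0, t]
    (EFin \o (fun s => h s * (A + B * \1_(`]a, +oo[%classic) s))).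
Proof.
move=> hint; have iint := integrableM_indic_ray a hint.
apply: eq_integrable (integrableD _ (integrableZl _ A hint) (integrableZl _ B iint)) => //.
by move=> s _ /=; rewrite -!EFinM -EFinD; congr (_%:E); ring.
Qed.

Lemma RintegralM_step h t a (A B : R) : mu.-integrable `[0, t] (EFin \o h) ->
  \int[mu]_(s in `[0, t]) (h s * (A + B * \1_(`]a, +oo[%classic) s)) =
  A * \int[mu]_(s in `[0, t]) h s +
  B * \int[mu]_(s in `[0, t]) (h s * \1_(`]a, +oo[%classic) s).
Proof.
move=> hint; have iint := integrableM_indic_ray a hint.
rewrite -!RintegralZl// -RintegralD//; last 2 first.
- exact: (integrableZl _ A hint).
- exact: (integrableZl _ B iint).
by apply: eq_Rintegral => s _; ring.
Qed.

(** The primitive [F] of [h] is continuous, so by the intermediate value theorem it takes the value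
    [lam - delta] at some [a], unless that value is out of range. *)
Lemma Rintegral_split_time h t (lam delta : R) : 0 <= t -> 0 <= delta ->
  mu.-integrable `[0, t] (EFin \o h) -> (forall r, 0 <= h r) ->
  \int[mu]_(r in `[0, t]) h r <= lam ->
  exists a : R,
    (forall s, 0 <= s <= t -> s <= a ->
       \int[mu]_(r in `[0, s]) h r <= lam - delta) /\
    \int[mu]_(r in `[0, t]) (h r * \1_(`]a, +oo[%classic) r) <= delta.
Proof.
move=> t0 delta0 hint h0 hlam.
pose F s := \int[mu]_(r in `[0, s]) h r.
have F_le s s' : 0 <= s -> s <= s' -> s' <= t -> F s <= F s'.
  move=> s0 ss' s't; apply: le_Rintegral_prefix => //; exact: integrable_prefix s't hint.
have F0 : F 0 = 0 by rewrite /F set_itv1 Rintegral_set1.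
(* If [lam < delta], the whole integral is below [delta], and [a = -1] makes the first condition
   void. *)
have [lam0|lam0] := ltP (lam - delta) 0.
  exists (-1); split=> [s /andP[s0 _]|]; first by lra.
  apply: (@le_trans _ _ (F t)); last by apply: (le_trans hlam); lra.
  apply: le_Rintegral => //; first exact: integrableM_indic_ray.
  move=> s _; rewrite indicE; case: (s \in _); rewrite ?mulr1// mulr0.
  exact: h0.
(* If the total is already at most [lam - delta], then [a = t] leaves an empty tail. *)
have [Ft|Ft] := leP (F t) (lam - delta).
  exists t; split=> [s /andP[s0 st] _|]; first exact: le_trans (F_le _ _ s0 st (lexx _)) Ft.
  rewrite (_ : \int[mu]_(r in _) _ = 0)//.
  rewrite /Rintegral integral0_eq// => s /=; rewrite in_itv /= => /andP[_ st].
  by rewrite indicE memNset ?mulr0//= in_itv /= andbT ltNge st.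
have Fcont : {within `[0, t], continuous F} by exact: parameterized_integral_continuous.
have [|a + Fa] := IVT t0 Fcont (v := lam - delta).
  by rewrite F0 ge_min le_max lam0 (ltW Ft) orbT.
rewrite in_itv /= => /andP[a0 at_].
exists a; split=> [s /andP[s0 st] sa|]; first by rewrite -Fa F_le.
have -> : \int[mu]_(r in `[0, t]) (h r * \1_(`]a, +oo[%classic) r) =
    \int[mu]_(r in `]a, t]) h r.
  have -> : `]a, t]%classic = `[0, t]%classic `&` `]a, +oo[%classic.
    apply/seteqP; split=> r /=; rewrite !in_itv /= andbT.
      by move=> /andP[ar rt]; rewrite ar rt (le_trans a0 (ltW ar)).
    by case=> /andP[_ ->] ->.
  rewrite Rintegral_mkcondr; apply: eq_Rintegral => r _.
  by rewrite patchE indicE; case: (r \in _); rewrite ?mulr1 ?mulr0.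
have Flam : F t <= lam by [].
by rewrite -(@Rintegral_itvB _ h (BLeft 0) (BRight t) a)// -/(F t) -/(F a) Fa; lra.
Qed.

End RealIntegrals.


(** * Controls of bounded L1 norm *)

Definition control_cost (R : realType) (m : nat) (u : 'I_m -> R -> R) (t : R) : R :=
  \int[@lebesgue_measure R]_(s in `[0, t]) \sum_(i < m) `|u i s|.

(** The set [K_(T, L)]. Each point is the end of a trajectory on its own interval [[0, t]], so that
    every state along a trajectory is reached at the cost of its own prefix. *)
Definition reachable_within (R : realType) (k : scalar_kind)
    (X : completeNormedModType (scalar_field R k)) (S : R -> {linear X -> X})
    (m : nat) (f : 'I_m -> X -> X) (xi0 : X) (T L : R) : set X :=
  [set y | exists (t : R) (u : 'I_m -> R -> R) (x : R -> X),
    [/\ 0 <= t <= T, L1_control t u, mild_solution S f xi0 t u x,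
        control_cost u t <= L & y = x t]].

Lemma mild_solution_prefix (R : realType) (k : scalar_kind)
    (X : completeNormedModType (scalar_field R k)) (S : R -> {linear X -> X})
    (m : nat) (f : 'I_m -> X -> X) (xi0 : X) (s t : R) (u : 'I_m -> R -> R) (x : R -> X) :
  s <= t -> mild_solution S f xi0 t u x -> mild_solution S f xi0 s u x.
Proof.
move=> st [xc xI]; split.
  by apply: continuous_subspaceW xc; apply: subset_itvl; rewrite bnd_simp.
move=> r; rewrite in_itv /= => /andP[r0 rs]; apply: xI.
by rewrite in_itv /= r0 (le_trans rs).
Qed.

Section Controls.
Context {R : realType} {m : nat}.
Notation mu := (@lebesgue_measure R).
Implicit Types (u : 'I_m -> R -> R) (t : R).

Lemma L1_control_prefix u s t : s <= t -> L1_control t u -> L1_control s u.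
Proof. by move=> st ut i; exact: integrable_prefix st (ut i). Qed.

Lemma L1_control_norm u t i : L1_control t u ->
  mu.-integrable `[0, t] (EFin \o (fun s => `|u i s|)).
Proof. by move=> ut; apply: integrable_norm; exact: ut. Qed.

Lemma L1_control_cost_integrable u t : L1_control t u ->
  mu.-integrable `[0, t] (EFin \o (fun s => \sum_(i < m) `|u i s|)).
Proof.
move=> ut.
have := @integrable_sum _ _ _ mu `[0, t]%classic (measurable_itv _) 'I_m
  (index_enum 'I_m) xpredT (fun i => EFin \o (fun s => `|u i s|))
  (fun i _ => L1_control_norm i ut).
by apply: eq_integrable => // s _ /=; rewrite sumEFin.
Qed.

Lemma sum_norm_ge0 u s : 0 <= \sum_(i < m) `|u i s|.
Proof. exact: sumr_ge0. Qed.

Lemma control_cost_ge0 u t : 0 <= control_cost u t.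
Proof. by apply: Rintegral_ge0 => s _; exact: sum_norm_ge0. Qed.

Lemma le_control_cost u s t : 0 <= s <= t -> L1_control t u ->
  control_cost u s <= control_cost u t.
Proof.
move=> /andP[s0 st] ut; apply: le_Rintegral_prefix => //.
  exact: L1_control_cost_integrable.
exact: sum_norm_ge0.
Qed.

Lemma Rintegral_le_control_cost u t i : L1_control t u ->
  \int[mu]_(s in `[0, t]) `|u i s| <= control_cost u t.
Proof.
move=> ut; apply: le_Rintegral => //.
- exact: L1_control_norm.
- exact: L1_control_cost_integrable.
- by move=> s _; rewrite (bigD1 i)//= lerDl sumr_ge0.
Qed.

Lemma sum_Rintegral_step u t (a A B L delta : R) : L1_control t u ->
  0 <= A -> 0 <= B -> control_cost u t <= L ->
  \int[mu]_(s in `[0, t]) ((\sum_(i < m) `|u i s|) * \1_(`]a, +oo[%classic) s)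
    <= delta ->
  \sum_(i < m) \int[mu]_(s in `[0, t]) (`|u i s| * (A + B * \1_(`]a, +oo[%classic) s))
    <= A * L + B * delta.
Proof.
move=> ut A0 B0 uL udelta.
rewrite -Rintegral_sum//; last first.
  by move=> i; apply: integrableM_step; exact: L1_control_norm.
under eq_Rintegral do rewrite -mulr_suml.
rewrite RintegralM_step; last exact: L1_control_cost_integrable.
by rewrite lerD// ler_wpM2l.
Qed.

Lemma control_cost_split u t (lam delta : R) : 0 <= t -> 0 <= delta ->
  L1_control t u -> control_cost u t <= lam ->
  exists a : R,
    (forall s, 0 <= s <= t -> s <= a -> control_cost u s <= lam - delta) /\
    \int[mu]_(s in `[0, t]) ((\sum_(i < m) `|u i s|) * \1_(`]a, +oo[%classic) s)
      <= delta.
Proof.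
move=> t0 d0 ut ul; apply: Rintegral_split_time => //.
  exact: L1_control_cost_integrable.
exact: sum_norm_ge0.
Qed.

End Controls.

(** Induction on the number of steps [delta] needed to make the budget negative, where no control
    exists. The cap [L] lets [delta] be fixed before the induction starts. *)
Lemma budget_ind (R : realType) (P : R -> Prop) (delta L : R) : 0 < delta ->
  (forall lam, lam < 0 -> P lam) ->
  (forall lam, lam <= L -> P (lam - delta) -> P lam) ->
  forall lam, lam <= L -> P lam.
Proof.
move=> d0 Pneg Pstep.
have H n lam : lam <= L -> lam < delta * n%:R -> P lam.
  elim: n lam => [|n IHn] lam lamL lamn; first by apply: Pneg; rewrite mulr0 in lamn.
  apply: Pstep => //; apply: IHn; first lra.
  by rewrite ltrBlDr; move: lamn; rewrite -natr1 mulrDr mulr1.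
move=> lam lamL; apply: (H (Num.truncn (lam / delta)).+1) => //.
by rewrite mulrC -ltr_pdivrMr// truncnS_gt.
Qed.

(** * Boundedness and total boundedness of the sets of bounded budget *)

Section ControlSystem.
Context {R : realType} {Y : completeNormedModType R}.
Notation mu := (@lebesgue_measure R).
Variable S : R -> {linear Y -> Y}.
Hypothesis S_bounded : forall t : R, 0 <= t ->
  exists2 M : R, 0 <= M & forall x, `|S t x| <= M * `|x|.
Hypothesis S0 : forall x, S 0 x = x.
Hypothesis SD : forall s t : R, 0 <= s -> 0 <= t -> forall x, S (s + t) x = S s (S t x).
Hypothesis S_cvg0 : forall x, S t x @[t --> 0^'+] --> x.
Variables (m : nat) (f : 'I_m -> Y -> Y).
Hypothesis f_continuous : forall i, continuous (f i).
Hypothesis f_lipschitz : forall B : R, exists2 l : R, 0 <= l &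
  forall i y z, `|y| <= B -> `|z| <= B -> `|f i y - f i z| <= l * `|y - z|.
Hypothesis f_linear_bound : exists a b : R,
  [/\ 0 <= a, 0 <= b & forall i y, `|f i y| <= a * `|y| + b].
Variable xi0 : Y.
Local Notation mild_solution := (@mild_solution R RealScalars Y S m f xi0).
Local Notation bochner t := (@is_bochner_integral R RealScalars Y _ _ mu `[0, t]%classic).
Local Notation reach := (@reachable_within R RealScalars Y S m f xi0).

Lemma mild_solutionE (t : R) u x : 0 <= t -> mild_solution t u x ->
  exists2 I : 'I_m -> Y, forall i, bochner t (fun s => u i s *: S (t - s) (f i (x s))) (I i) &
    x t = S t xi0 + \sum_(i < m) I i.
Proof.
move=> t0 [_ /(_ t)[|I [II xI]]]; first by rewrite in_itv /= t0 lexx.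
exists I => // i.
rewrite (_ : (fun s => _) = (fun s => S (t - s) (@rscale R RealScalars Y (u i s) (f i (x s)))))//.
by apply/funext => s; rewrite -linearZ.
Qed.

Lemma mild_solution_reach (T L t s : R) u x : 0 <= s <= t -> t <= T ->
  L1_control t u -> mild_solution t u x -> control_cost u s <= L -> reach T L (x s).
Proof.
move=> /andP[s0 st] tT ut xt us; exists s, u, x; split=> //.
- by rewrite s0 (le_trans st).
- exact: L1_control_prefix ut.
- exact: mild_solution_prefix xt.
Qed.

Lemma reach_negative (T L : R) y : L < 0 -> ~ reach T L y.
Proof.
move=> L0 [t [u [x [_ _ _ uL _]]]].
by have := control_cost_ge0 u t; rewrite leNgt (le_lt_trans uL).
Qed.

(** Let [|x|] be maximal at time [c]. After the splitting time, the linear bound involves [|x c|]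
    itself, but with total coefficient [M * al * delta <= 1/2], so this term is absorbed on the
    left; hence the factor 2 in the bound. *)
Lemma reach_bounded (T L : R) : exists B : R, forall y, reach T L y -> `|y| <= B.
Proof.
have [M M1 SM] := semigroup_bounded S_bounded S0 SD S_cvg0 T.
have M0 : 0 < M by exact: lt_le_trans M1.
have [al [be [al0 be0 f_le]]] := f_linear_bound.
pose delta := (2 * (M * al + 1))^-1.
have Mal0 : 0 <= M * al by rewrite mulr_ge0// ltW.
have delta0 : 0 < delta by rewrite invr_gt0; lra.
have Mald : M * al * delta <= 2^-1.
  by rewrite /delta ler_pdivrMr; lra.
apply: (@budget_ind R (fun L => exists B : R, forall y, reach T L y -> `|y| <= B)
  delta L delta0) (lexx L) => [lam lam0|lam _ [B0 BP]].
  by exists 0 => y /(reach_negative lam0).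
(* [B0] may be negative if the set of smaller budget is empty. *)
pose B := `|B0|; have B0' : 0 <= B by exact: normr_ge0.
pose A := M * (al * B + be).
have A0 : 0 <= A by rewrite mulr_ge0 ?addr_ge0 ?mulr_ge0// ltW.
exists (2 * (M * `|xi0| + A * lam)) => _ [t [u [x [/andP[t0 tT] ut xt ulam ->]]]].
have normxc : {within `[0, t], continuous (fun s => `|x s|)}.
  have [/subspace_continuousP xc _] := xt.
  by apply/subspace_continuousP => s st; apply: cvg_norm; exact: xc.
have [c + xc] := EVT_max t0 normxc.
rewrite in_itv /= => /andP[c0 ct].
have {}xc s : 0 <= s <= t -> `|x s| <= `|x c|.
  by move=> st; apply: xc; rewrite in_itv.
apply: (le_trans (xc t _)); first by rewrite t0 lexx.
have uc := L1_control_prefix ct ut.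
have ucl : control_cost u c <= lam.
  by apply: le_trans ulam; apply: le_control_cost => //; rewrite c0.
have [a [ua da]] := control_cost_split c0 (ltW delta0) uc ucl.
have [I II xcE] := mild_solutionE c0 (mild_solution_prefix ct xt).
(* By the induction hypothesis [A] bounds the integrand up to [a]; [E] is the excess allowed after
   [a]. *)
pose E := M * al * `|x c|.
have E0 : 0 <= E by rewrite mulr_ge0.
have I_le i : `|I i| <= \int[mu]_(s in `[0, c])
    (`|u i s| * (A + E * \1_(`]a, +oo[%classic) s)).
  apply: (bochner_integral_norm_le _ (II i)) => //.
    by apply: integrableM_step; exact: L1_control_norm.
  move=> s /=; rewrite in_itv /= => /andP[s0 sc].
  apply: (le_trans (SM _ _ _)); first by rewrite subr_ge0 sc; lra.
  apply: (@le_trans _ _ (M * (al * `|x s| + be))); first by rewrite ler_pM2l.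
  rewrite indicE; have [sa|sa] := leP s a.
    rewrite memNset ?mulr0 ?addr0; last by rewrite /= in_itv /= andbT ltNge sa.
    rewrite ler_pM2l// lerD2r ler_wpM2l// (le_trans _ (ler_norm B0))//.
    apply: BP; apply: (mild_solution_reach (t := t)) ut xt _ => //.
      by rewrite s0 (le_trans sc).
    by apply: ua => //; rewrite s0.
  rewrite mem_set ?mulr1; last by rewrite /= in_itv /= andbT.
  have : al * `|x s| <= al * `|x c| by rewrite ler_wpM2l// xc// s0 (le_trans sc).
  rewrite -(ler_pM2l M0) /A /E !mulrDr !mulrA.
  have : 0 <= M * al * B by rewrite mulr_ge0.
  by lra.
have Ed : E * delta <= 2^-1 * `|x c| by rewrite /E mulrAC ler_wpM2r.
have : `|x c| <= M * `|xi0| + (A * lam + E * delta).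
  rewrite {1}xcE (le_trans (ler_normD _ _))// lerD//.
    by apply: SM; rewrite c0 (le_trans ct).
  apply: (le_trans (ler_norm_sum _ _ _)).
  apply: le_trans (sum_Rintegral_step uc A0 E0 ucl da).
  by apply: ler_sum => i _; exact: I_le.
by lra.
Qed.

(** These are the possible values of [S (t - s) (f i (x s))] once the state [x s] is replaced by a
    net point; the points [p_j] come from a net of this set. *)
Lemma totally_bounded_orbits (T : R) (s : seq Y) : totally_bounded
  [set y | exists2 z, z \in s &
    exists2 i, i \in enum 'I_m & ((fun t => S t (f i z)) @` `[0, T]) y].
Proof.
apply: totally_bounded_bigcup => z _; apply: totally_bounded_bigcup => i _.
apply: compact_totally_bounded; apply: continuous_compact; last exact: segment_compact.
exact: semigroup_orbit_continuous.
Qed.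

Lemma totally_bounded_box (n : nat) (P : 'I_n -> Y) (L : R) :
  totally_bounded [set \sum_j y j | y in
    [set y | forall j, ((fun c : R => c *: P j) @` `[- L, L]) (y j)]].
Proof.
apply: (totally_bounded_sum (A := fun j => (fun c : R => c *: P j) @` `[- L, L])) => j.
apply: compact_totally_bounded.
apply: continuous_compact; last exact: segment_compact.
by apply: continuous_subspaceT => c; exact: scalel_continuous.
Qed.

Lemma measurable_near_point (t : R) (h : R -> Y) (p : Y) (rho : R -> R) :
  {within `[0, t], continuous h} -> measurable_fun `[0, t] rho ->
  measurable (`[0, t] `&` [set s | `|h s - p| <= rho s]).
Proof.
move=> hc mrho.
have mh : measurable_fun `[0, t] (fun s => `|h s - p| - rho s).
  apply: measurable_funB => //; apply: subspace_continuous_measurable_fun => //.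
  move: hc => /subspace_continuousP hc; apply/subspace_continuousP => s st.
  by apply: cvg_norm; apply: cvgB; [exact: hc|exact: cvg_cst].
rewrite (_ : [set s | _] = (fun s => `|h s - p| - rho s) @^-1` `]-oo, 0]).
  exact: mh.
by apply/seteqP; split=> s /=; rewrite in_itv /= subr_le0.
Qed.

Lemma reach_totally_bounded (T L : R) : totally_bounded (reach T L).
Proof.
have [M M1 SM] := semigroup_bounded S_bounded S0 SD S_cvg0 T.
have M0 : 0 < M by exact: lt_le_trans M1.
have [B BP] := reach_bounded T L.
have [l l0 lP] := f_lipschitz B.
have Ml0 : 0 <= M * l by rewrite mulr_ge0// ltW.
(* With this [delta], an error [M * l * (e + e)] confined to times after the split contributes at
   most [e / 4]. *)
pose delta := (8 * (M * l + 1))^-1.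
have delta0 : 0 < delta by rewrite invr_gt0; lra.
have Mld : M * l * delta <= 8^-1 by rewrite /delta ler_pdivrMr; lra.
apply: (@budget_ind R (fun L => totally_bounded (reach T L)) delta L delta0) (lexx L).
  by move=> lam lam0 e _; exists [::] => y /(reach_negative lam0).
move=> lam lamL tlam.
have BPl y : reach T lam y -> `|y| <= B.
  move=> [t [u [x [t0 ut xt ul ->]]]]; apply: BP; exists t, u, x; split=> //.
  exact: le_trans ul lamL.
(* Starting from the single centre 0 with radius [|B| + 1], iterated contraction by [3 / 4] reaches
   every radius. *)
suff contraction (e : R) : 0 < e ->
    finite_net e (reach T lam) -> finite_net (3 / 4 * e) (reach T lam).
  have B0 : 0 < `|B| + 1 by rewrite ltr_wpDl.
  have netn n : finite_net ((3 / 4) ^+ n * (`|B| + 1)) (reach T lam).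
    elim: n => [|n IHn]; last first.
      by rewrite exprS -mulrA; apply: contraction => //; rewrite mulr_gt0// exprn_gt0.
    exists [:: 0] => y /BPl yB; exists 0; first exact: mem_head.
    by rewrite subr0 mul1r; have := ler_norm B; lra.
  move=> e e0.
  have q1 : `|3 / 4 : R| < 1 by rewrite gtr0_norm; lra.
  have /cvgrPdist_lt/(_ e e0) := cvg_geometric (`|B| + 1) q1.
  move=> /filter_ex[n /=]; rewrite sub0r normrN => ne.
  apply: le_finite_net (netn n); rewrite mulrC ltW//.
  by apply: le_lt_trans ne; exact: ler_norm.
(* The centres must be reachable to lie in the ball of radius [B], where the Lipschitz constant [l]
   is valid; the price is the radius [e + e]. *)
move=> e0 /finite_net_centers[r [rR rP]].
pose L0 := `|L|; have L00 : 0 <= L0 by exact: normr_ge0.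
(* The base error [A = kap + kap], weighted by the whole budget, then contributes at most
   [e / 8]. *)
pose kap := e / (16 * (L0 + 1)).
have kap0 : 0 < kap by rewrite divr_gt0//; lra.
have kapL : 2 * kap * L0 <= e / 8.
  rewrite /kap mulrAC mulrA ler_pdivrMr; last by lra.
  have : 0 <= e * L0 by rewrite mulr_ge0// ltW.
  by nra.
(* Replacing a state by one within [eps] changes the integrand by at most [kap]. The net is taken
   with [eps / 2] because [finite_net_centers] doubles the radius. *)
pose eps := kap / (M * l + 1).
have Ml1 : 0 < M * l + 1 by rewrite ltr_wpDl.
have eps0 : 0 < eps by rewrite divr_gt0.
have Mleps : M * l * eps <= kap.
  rewrite /eps mulrA ler_pdivrMr// mulrC ler_pM2l//; lra.
have [|q [qR qP]] := finite_net_centers (tlam (eps / 2) _); first by rewrite divr_gt0.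
have [p pP] := totally_bounded_orbits T (q ++ r) kap0.
pose P j := tnth (in_tuple p) j.
(* The values of the variation of constants formula when each integral is replaced by a combination
   of the [P j] with coefficients in [[- L0, L0]]. *)
pose C := [set x + y | x in (fun t => S t xi0) @` `[0, T] &
  y in [set \sum_i z i | z in [set z : 'I_m -> Y | forall i,
    [set \sum_j y j | y in
      [set y | forall j, ((fun c : R => c *: P j) @` `[- L0, L0]) (y j)]] (z i)]]].
have tC : totally_bounded C.
  apply: totally_boundedD.
    apply: compact_totally_bounded; apply: continuous_compact; last exact: segment_compact.
    exact: semigroup_orbit_continuous.
  by apply: (totally_bounded_sum (A := fun i => _)) => i; exact: totally_bounded_box.
(* One half is the distance from [x t] to [C], namely [e / 8 + e / 4]; the other is the radius of a
   net of [C]. *)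
rewrite (_ : 3 / 4 * e = 3 / 8 * e + 3 / 8 * e); last by field.
apply: (finite_net_near (B := C)); first by apply: tC; lra.
move=> _ [t [u [x [/andP[t0 tT] ut xt ul ->]]]].
have [a [ua da]] := control_cost_split t0 (ltW delta0) ut ul.
have [I II xE] := mild_solutionE t0 xt.
pose A := kap + kap; have A0 : 0 <= A by rewrite addr_ge0// ltW.
pose E := M * l * (e + e); have E0 : 0 <= E by rewrite mulr_ge0//; lra.
pose rho s := A + E * \1_(`]a, +oo[%classic) s.
have ul0 : control_cost u t <= L0.
  by apply: (le_trans ul); apply: (le_trans lamL); exact: ler_norm.
have xlam s : 0 <= s <= t -> reach T lam (x s).
  move=> st; apply: (mild_solution_reach (t := t)) => //.
  by apply: le_trans ul; exact: le_control_cost.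
(* Replacing [x s] by [z] costs the Lipschitz term, and replacing the resulting orbit point by some
   [P j] costs [kap]. Taking [z] in [q] up to time [a] and in [r] afterwards gives the profile
   [rho]. *)
have near_p i s z : 0 <= s <= t -> z \in q ++ r ->
    exists j, `|S (t - s) (f i (x s)) - P j| <= M * l * `|x s - z| + kap.
  move=> /andP[s0 st] zqr.
  have zB : `|z| <= B.
    move: zqr; rewrite mem_cat => /orP[/qR|/rR]; last exact: BPl.
    move=> [t' [u' [x' [t'0 ut' xt' ul' ->]]]]; apply: BPl; exists t', u', x'.
    by split=> //; apply: (le_trans ul'); lra.
  have [|w wp zw] := pP (S (t - s) (f i z)).
    exists z => //; exists i; first by rewrite mem_enum.
    by exists (t - s) => //=; rewrite in_itv /=; lra.
  have wsz : (index w p < size p)%N by rewrite index_mem.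
  exists (Ordinal wsz); rewrite /P (tnth_nth 0) /= nth_index//.
  rewrite (le_trans (ler_distD (S (t - s) (f i z)) _ _))// lerD//; last exact: ltW.
  rewrite -linearB; apply: (le_trans (SM _ _ _)); first by lra.
  rewrite -mulrA ler_pM2l//; apply: lP => //.
  by apply: BPl; apply: xlam; rewrite s0.
have approx i : exists c : 'I_(size p) -> R, (forall j, `|c j| <= L0) /\
    `|I i - \sum_j c j *: P j| <= \int[mu]_(s in `[0, t]) (`|u i s| * rho s).
  have [|||c [cL cI]] := @bochner_integral_near_net R Y _ _ mu
    `[0, t]%classic (measurable_itv _) (u i) (fun s => S (t - s) (f i (x s)))
    (I i) _ P rho (II i) (ut i).
  - by apply: integrableM_step; exact: L1_control_norm.
  - move=> j; apply: measurable_near_point.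
      apply: semigroup_shift_continuous => //.
      have [/subspace_continuousP xc _] := xt.
      apply/subspace_continuousP => s st.
      by apply: (@cvg_comp _ _ _ x (f i) _ _ _ (xc s st)); exact: f_continuous.
    by apply: measurable_funD => //; exact: measurable_funM.
  - move=> s /=; rewrite in_itv /= => st.
    rewrite /rho indicE; have [sa|sa] := leP s a.
      rewrite memNset ?mulr0 ?addr0; last by rewrite /= in_itv /= andbT ltNge sa.
      have [|z zq xz] := qP (x s).
        apply: (mild_solution_reach (t := t)) => //.
        exact: ua.
      have [|j jP] := near_p i s z st; first by rewrite mem_cat zq.
      exists j; apply: (le_trans jP); rewrite lerD2r.
      by apply: le_trans Mleps; rewrite ler_wpM2l// [eps]splitr ltW.
    rewrite mem_set ?mulr1; last by rewrite /= in_itv /= andbT.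
    have [z zr xz] := rP _ (xlam _ st).
    have [|j jP] := near_p i s z st; first by rewrite mem_cat zr orbT.
    exists j; apply: (le_trans jP).
    have : M * l * `|x s - z| <= E by rewrite ler_wpM2l// ltW.
    by rewrite /A; lra.
  exists c; split=> // j; apply: (le_trans (cL j)).
  exact: le_trans (Rintegral_le_control_cost i ut) ul0.
have [c cP] := choice approx.
exists (S t xi0 + \sum_i \sum_j c i j *: P j).
  exists (S t xi0); first by exists t => //=; rewrite in_itv /= t0.
  exists (\sum_i \sum_j c i j *: P j) => //.
  exists (fun i => \sum_j c i j *: P j) => // i.
  exists (fun j => c i j *: P j) => // j.
  exists (c i j) => //=; rewrite in_itv /= -ler_norml.
  by have [cL _] := cP i; exact: cL.
rewrite xE opprD addrACA subrr add0r -sumrB.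
apply: (le_trans (ler_norm_sum _ _ _)).
apply: (@le_trans _ _ (A * L0 + E * delta)).
  apply: le_trans (sum_Rintegral_step ut A0 E0 ul0 da).
  by apply: ler_sum => i _; have [_] := cP i.
have : E * delta <= 8^-1 * (e + e) by rewrite /E mulrAC ler_wpM2r//; lra.
have : A * L0 <= e / 8 by move: kapL; rewrite /A; lra.
by lra.
Qed.

End ControlSystem.

(** * Transfer from [X] to its underlying real Banach space *)

Section Transfer.
Context {R : realType} {k : scalar_kind} {X : completeNormedModType (scalar_field R k)}.
Local Notation Y := (realified X : completeNormedModType R).

Lemma realified_linear_subproof (g : {linear X -> X}) :
  linear (g : realified X -> realified X).
Proof. by move=> r x y; exact: linearP. Qed.

Definition realified_linear (g : {linear X -> X}) :
    {linear realified X -> realified X} :=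
  HB.pack (g : realified X -> realified X)
    (GRing.isLinear.Build R (realified X) (realified X) *:%R
       (g : realified X -> realified X) (realified_linear_subproof g)).

(** The same simple functions serve: norms and integrals agree by computation, and the convergences
    are transported by [realified_cvgE]. *)
Lemma realified_bochner_integral (d : measure_display) (T : measurableType d)
    (mu : {measure set T -> \bar R}) (D : set T) (g : T -> X) (v : X) :
  is_bochner_integral mu D g v ->
  @is_bochner_integral R RealScalars Y d T mu D g v.
Proof.
case=> s [s1 s2 s3 s4]; exists s; split.
- exact: s1.
- by move: s2; apply: filterS => x /= h Dx; have /realified_cvgE := h Dx; exact.
- exact: s3.
- by move/realified_cvgE: s4; exact.
Qed.

Lemma realified_mild_solution (S : R -> {linear X -> X}) (m : nat)
    (f : 'I_m -> X -> X) (xi0 : X) (t : R) u (x : R -> X) :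
  mild_solution S f xi0 t u x ->
  @mild_solution R RealScalars Y (fun t => realified_linear (S t)) m f xi0 t u x.
Proof.
move=> [/subspace_continuousP xc xI]; split.
  by apply/subspace_continuousP => s st; have /realified_cvgE := xc s st; exact.
move=> s /xI[I [II xE]]; exists I; split; last exact: xE.
by move=> i; apply: realified_bochner_integral; exact: II.
Qed.

Lemma realified_totally_bounded (A : set X) :
  totally_bounded (A : set Y) -> totally_bounded A.
Proof.
move=> tA e e0; have [s sP] := tA _ (real_of_scalar_gt0 e0).
exists s => x /sP[y ys xy]; exists y => //.
by rewrite -scalar_of_rnorm -[e]ge0_real_of_scalarK 1?ltW// ltr_scalar_of_real.
Qed.

Lemma rnorm_le_affine (x y : X) (a b : scalar_field R k) : 0 <= a -> 0 <= b ->
  `|x| <= a * `|y| + b -> rnorm x <= real_of_scalar a * rnorm y + real_of_scalar b.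
Proof.
move=> a0 b0; rewrite -(ler_scalar_of_real (k := k)) scalar_of_realD.
by rewrite scalar_of_realM !scalar_of_rnorm !ge0_real_of_scalarK.
Qed.

Lemma rnorm_le_scale (x y : X) (a : scalar_field R k) : 0 <= a ->
  `|x| <= a * `|y| -> rnorm x <= real_of_scalar a * rnorm y.
Proof.
move=> a0; rewrite -(ler_scalar_of_real (k := k)) scalar_of_realM.
by rewrite !scalar_of_rnorm ge0_real_of_scalarK.
Qed.

Lemma bounded_set_rnorm (B : R) : bounded_set [set x : X | rnorm x <= B].
Proof.
exists (scalar_of_real k B); split.
  by rewrite realE -(scalar_of_real0 (k := k)) !ler_scalar_of_real -realE num_real.
move=> M BM x /= xB; apply: le_trans (ltW BM).
by rewrite -scalar_of_rnorm ler_scalar_of_real.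
Qed.

Lemma lipschitz_on_bounded_sets_rnorm (m : nat) (f : 'I_m -> X -> X) :
  (forall i, lipschitz_on_bounded_sets (f i)) ->
  forall B : R, exists2 l : R, 0 <= l & forall i y z, rnorm y <= B -> rnorm z <= B ->
    rnorm (f i y - f i z) <= l * rnorm (y - z).
Proof.
move=> fl B.
have /choice[l lP] : forall i, exists l : R, 0 <= l /\ forall y z : X,
    rnorm y <= B -> rnorm z <= B -> rnorm (f i y - f i z) <= l * rnorm (y - z).
  move=> i; have [l l0 lf] := fl i _ (bounded_set_rnorm B).
  exists (real_of_scalar l); split; first exact: real_of_scalar_ge0.
  by move=> y z yB zB; apply: rnorm_le_scale => //; exact: (lf (y, z)).
(* A sum of nonnegative constants dominates each of them, so it serves all [i] at once. *)
exists (\sum_i l i); first by apply: sumr_ge0 => i _; have [] := lP i.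
move=> i y z yB zB; have [_ /(_ _ _ yB zB) /le_trans] := lP i; apply.
rewrite ler_wpM2r//; first exact: (normr_ge0 (_ : Y)).
by rewrite (bigD1 i)//= lerDl sumr_ge0// => j _; have [] := lP j.
Qed.

Lemma linearly_bounded_rnorm (m : nat) (f : 'I_m -> X -> X) :
  (forall i, linearly_bounded (f i)) ->
  exists a b : R, [/\ 0 <= a, 0 <= b &
    forall i y, rnorm (f i y) <= a * rnorm y + b].
Proof.
move=> fb.
have /choice[ab abP] : forall i, exists ab : R * R, [/\ 0 <= ab.1, 0 <= ab.2 &
    forall y, rnorm (f i y) <= ab.1 * rnorm y + ab.2].
  move=> i; have [a [b [a0 b0 abf]]] := fb i.
  exists (real_of_scalar a, real_of_scalar b); split.
  - exact: real_of_scalar_ge0.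
  - exact: real_of_scalar_ge0.
  - by move=> y; exact: rnorm_le_affine.
exists (\sum_i (ab i).1), (\sum_i (ab i).2); split.
- by apply: sumr_ge0 => i _; have [] := abP i.
- by apply: sumr_ge0 => i _; have [] := abP i.
move=> i y; have [_ _ /(_ y) /le_trans] := abP i; apply; apply: lerD.
  rewrite ler_wpM2r//; first exact: (normr_ge0 (_ : Y)).
  by rewrite (bigD1 i)//= lerDl sumr_ge0// => j _; have [] := abP j.
by rewrite (bigD1 i)//= lerDl sumr_ge0// => j _; have [] := abP j.
Qed.

Lemma reachable_within_totally_bounded (S : R -> {linear X -> X}) (m : nat)
    (f : 'I_m -> X -> X) (xi0 : X) (T L : R) :
  C0_semigroup S -> (forall i, continuous (f i)) ->
  (forall i, lipschitz_on_bounded_sets (f i)) ->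
  (forall i, linearly_bounded (f i)) ->
  totally_bounded (reachable_within S f xi0 T L : set Y).
Proof.
move=> [S_bd S0 SD S_cvg] fc fl fb.
apply: (@totally_boundedS _ _ _ (@reachable_within R RealScalars Y
    (fun t => realified_linear (S t)) m f xi0 T L)).
  move=> _ [t [u [x [tT ut xt uL ->]]]]; exists t, u, x; split=> //.
  exact: realified_mild_solution.
apply: (@reach_totally_bounded R Y (fun t => realified_linear (S t))).
- move=> t /S_bd[M M0 SM]; exists (real_of_scalar M); first exact: real_of_scalar_ge0.
  by move=> x; apply: rnorm_le_scale => //; exact: SM.
- exact: S0.
- exact: SD.
- by move=> x; have /realified_cvgE := S_cvg x; exact.
- by move=> i x A /realified_nbhsE /(fc i x) /realified_nbhsE.
- exact: lipschitz_on_bounded_sets_rnorm.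
- exact: linearly_bounded_rnorm.
Qed.

End Transfer.

(** * The reachable set as a countable union *)

Lemma reachable_setE (R : realType) (k : scalar_kind)
    (X : completeNormedModType (scalar_field R k)) (S : R -> {linear X -> X})
    (m : nat) (f : 'I_m -> X -> X) (xi0 : X) :
  reachable_set S f xi0 = \bigcup_n reachable_within S f xi0 n%:R n%:R.
Proof.
apply/seteqP; split=> y.
  move=> [T [T0 [u [uT [x [xT [t [+ ->]]]]]]]]; rewrite in_itv /= => /andP[t0 tT].
  have [n [tn un]] : exists n : nat, t <= n%:R /\ control_cost u t <= n%:R.
    (* Both terms are nonnegative, so an integer above their sum bounds each. *)
    exists (Num.truncn (t + control_cost u t)).+1.
    have := truncnS_gt (t + control_cost u t); have := control_cost_ge0 u t.
    by move=> *; split; lra.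
  exists n => //; exists t, u, x; split=> //; first by rewrite t0.
    exact: L1_control_prefix uT.
  exact: mild_solution_prefix xT.
move=> [n _ [t [u [x [/andP[t0 tn] ut xt _ ->]]]]].
exists t; split=> //; exists u; split=> //; exists x; split=> //.
by exists t; rewrite in_itv /= t0 lexx.
Qed.

Theorem theorem3p11 (R : realType) (k : scalar_kind)
    (X : completeNormedModType (scalar_field R k))
    (domA : set X) (A : X -> X) (S : R -> {linear X -> X})
    (m : nat) (f : 'I_m -> X -> X)
    (S_semigroup : C0_semigroup S)
    (A_generator : infinitesimal_generator domA A S)
    (f_continuous : forall i, continuous (f i))
    (f_lipschitz : forall i, lipschitz_on_bounded_sets (f i))
    (f_linear_bound : forall i, linearly_bounded (f i))
    (xi0 : X) :
  (exists K : nat -> set X,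
     (forall n, compact (closure (K n))) /\
     reachable_set S f xi0 = \bigcup_n K n) /\
  (infinite_dimensional X -> interior (reachable_set S f xi0) = set0).
Proof.
have tK (n : nat) : totally_bounded
    (reachable_within S f xi0 n%:R n%:R : set (realified X)).
  exact: reachable_within_totally_bounded.
split.
  exists (fun n => reachable_within S f xi0 n%:R n%:R); split.
    move=> n; apply: totally_bounded_compact_closure.
    exact: realified_totally_bounded.
  exact: reachable_setE.
move=> Xinf; rewrite -subset0 => y.
rewrite /interior reachable_setE => /realified_nbhsE /nbhs_ballP[r /= r0 yr].
apply: Xinf; have [n [e eP]] := bigcup_totally_bounded_ball r0 tK yr.
(* A family spanning [X] over the reals also spans it over the scalar field. *)
exists n, e => x; have [c xc] := eP x.
by exists (fun i => scalar_of_real k (c i)).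
Qed.
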